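(* Let $\mathcal X$ and $\mathcal Y$ be Ahlfors $n_1$-regular and $n_2$-regular spaces, respectively, with $n_1,n_2\in(0,\infty)$, and let $f:\mathcal X\to\mathcal Y$ be a quasisymmetric mapping onto $\mathcal Y$. Let $s_i\in(0,n_i)$, $i=1,2$, with $n_1/s_1=n_2/s_2$. Then $f$ induces an equivalence between $\dot M^{s_1}_{n_1/s_1,n_1/s_1}(\mathcal X)$ and $\dot M^{s_2}_{n_2/s_2,n_2/s_2}(\mathcal Y)$, and hence between $\dot{\mathcal B}^{s_1}_{n_1/s_1}(\mathcal X)$ and $\dot{\mathcal B}^{s_2}_{n_2/s_2}(\mathcal Y)$, in the following sense: there is $C>0$ such that every $u\in\dot M^{s_2}_{n_2/s_2,n_2/s_2}(\mathcal Y)$ has a representative $\widetilde u$ (equal to $u$ $\mu_{\mathcal Y}$-a.e.) with $\widetilde u\circ f\in\dot M^{s_1}_{n_1/s_1,n_1/s_1}(\mathcal X)$ and $\|\widetilde u\circ f\|_{\dot M^{s_1}_{n_1/s_1,n_1/s_1}(\mathcal X)}\le C\|u\|_{\dot M^{s_2}_{n_2/s_2,n_2/s_2}(\mathcal Y)}$, and symmetrically every $v\in\dot M^{s_1}_{n_1/s_1,n_1/s_1}(\mathcal X)$ has a representative $\widetilde v$ with $\|\widetilde v\circ f^{-1}\|_{\dot M^{s_2}_{n_2/s_2,n_2/s_2}(\mathcal Y)}\le C\|v\|_{\dot M^{s_1}_{n_1/s_1,n_1/s_1}(\mathcal X)}$; the same holds for the $\dot{\mathcal B}$ spaces.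
   Context: Metric measure space: $d$ metric, $\mu$ regular Borel, balls of finite positive measure. Ahlfors $n$-regular: $\mu(B(x,r))\sim r^n$ for all $x$ and $0<r<2\operatorname{diam}\mathcal X$. A homeomorphism $f:\mathcal X\to\mathcal Y$ is $\eta$-quasisymmetric (for a homeomorphism $\eta:[0,\infty)\to[0,\infty)$) if $d_{\mathcal Y}(f(x),f(a))/d_{\mathcal Y}(f(x),f(b))\le\eta(d_{\mathcal X}(x,a)/d_{\mathcal X}(x,b))$ for all $a,b,x$ with $x\ne b$. For measurable $u$ and $s>0$, $\mathbb D^s(u)$ is the set of sequences $\{g_k\}_{k\in\mathbb Z}$ of nonnegative measurable functions with a null set $E$ such that $|u(x)-u(y)|\le d(x,y)^s[g_k(x)+g_k(y)]$ for all $k$, $x,y\notin E$ with $2^{-k-1}\le d(x,y)<2^{-k}$; $\|u\|_{\dot M^s_{p,p}}=\inf_{\vec g\in\mathbb D^s(u)}(\int\sum_kg_k^p\,d\mu)^{1/p}$, $\dot M^s_{p,p}$ the measurable $u$ with this finite. $V(x,y)=\mu(B(x,d(x,y)))$; for $p\ge1$, $\dot{\mathcal B}^s_p$ is the set of $u\in L^p_{\rm loc}$ with $\int\int\frac{|u(x)-u(y)|^p}{d(x,y)^{sp}V(x,y)}d\mu(y)d\mu(x)<\infty$ (its $p$-th root being the norm). *)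

(* Defs.v *)
From HB Require Import structures.
From mathcomp Require Import all_boot all_order all_algebra.
From mathcomp Require Import all_classical all_reals all_analysis measurable_realfun.
Set Implicit Arguments. Unset Strict Implicit. Unset Printing Implicit Defensive.
Import Order.TTheory GRing.Theory Num.Theory.
Local Open Scope classical_set_scope.
Local Open Scope ring_scope.

Section Defs.
Context {R : realType}.

Definition is_metric (T : Type) (d : T -> T -> R) : Prop :=
  [/\ forall x y, 0 <= d x y,
      forall x y, d x y = 0 <-> x = y,
      forall x y, d x y = d y x &
      forall x y z, d x z <= d x y + d y z].

Definition mball (T : Type) (d : T -> T -> R) (x : T) (r : R) : set T :=
  [set y | d x y < r].

Definition metric_open (T : Type) (d : T -> T -> R) : set (set T) :=
  [set U | forall x, U x -> exists2 r : R, 0 < r & mball d x r `<=` U].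

Definition metric_continuous (T U : Type) (dT : T -> T -> R) (dU : U -> U -> R)
  (f : T -> U) : Prop :=
  forall x (e : R), 0 < e -> exists2 del : R, 0 < del &
    forall y, dT x y < del -> dU (f x) (f y) < e.

Definition homeo_halfline (eta : R -> R) : Prop :=
  exists etainv : R -> R,
  ([/\ forall t, 0 <= t -> 0 <= eta t,
      forall t, 0 <= t -> 0 <= etainv t,
      forall t, 0 <= t -> etainv (eta t) = t,
      forall t, 0 <= t -> eta (etainv t) = t &
    (forall t e, 0 <= t -> 0 < e -> exists2 del, 0 < del &
         forall t', 0 <= t' -> `|t' - t| < del -> `|eta t' - eta t| < e)] /\
    (forall t e, 0 <= t -> 0 < e -> exists2 del, 0 < del &
         forall t', 0 <= t' -> `|t' - t| < del -> `|etainv t' - etainv t| < e)).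

Definition quasisymmetric (X Y : Type) (dX : X -> X -> R) (dY : Y -> Y -> R)
  (f : X -> Y) (finv : Y -> X) : Prop :=
  [/\ cancel f finv, cancel finv f,
      metric_continuous dX dY f, metric_continuous dY dX finv &
      exists eta : R -> R, homeo_halfline eta /\
        forall a b x, x <> b ->
          dY (f x) (f a) / dY (f x) (f b) <= eta (dX x a / dX x b)].

(** r < 2 diam X, diam X being the (possibly infinite) supremum of distances *)
Definition lt_2diam (X : Type) (d : X -> X -> R) (r : R) : Prop :=
  exists x y, r < 2 * d x y.

Definition metric_measure_space {dsp : measure_display} (X : measurableType dsp)
  (d : X -> X -> R) (mu : {measure set X -> \bar R}) : Prop :=
  [/\ is_metric d,
      @measurable _ X = <<s metric_open d >>,
      (forall A : set X, measurable A ->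
         mu A = ereal_inf [set mu U | U in [set U | metric_open d U /\ A `<=` U]]) &
      forall x (r : R), 0 < r -> (0 < mu (mball d x r) < +oo)%E].

Definition ahlfors_regular {dsp : measure_display} (X : measurableType dsp)
  (d : X -> X -> R) (mu : {measure set X -> \bar R}) (n : R) : Prop :=
  exists2 C : R, 1 <= C & forall x (r : R), 0 < r -> lt_2diam d r ->
    (((C^-1 * powR r n)%:E <= mu (mball d x r)) /\
     (mu (mball d x r) <= (C * powR r n)%:E))%E.

Definition hajlasz_grad {dsp : measure_display} (X : measurableType dsp)
  (d : X -> X -> R) (mu : {measure set X -> \bar R}) (s : R) (u : X -> R)
  (g : int -> X -> \bar R) : Prop :=
  (forall k, measurable_fun setT (g k)) /\
  (forall k x, (0 <= g k x)%E) /\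
  exists E : set X, mu.-negligible E /\
    forall (k : int) x y, ~ E x -> ~ E y ->
      powR 2 (- (k%:~R) - 1) <= d x y < powR 2 (- (k%:~R)) ->
      ((`|u x - u y|)%:E <= (powR (d x y) s)%:E * (g k x + g k y))%E.

Definition Mnorm {dsp : measure_display} (X : measurableType dsp)
  (d : X -> X -> R) (mu : {measure set X -> \bar R}) (s p : R) (u : X -> R)
  : \bar R :=
  ereal_inf [set poweR (\int[mu]_x esum [set: int] (fun k => poweR (g k x) p)) p^-1
            | g in [set g | hajlasz_grad d mu s u g]].

Definition in_Mdot {dsp : measure_display} (X : measurableType dsp)
  (d : X -> X -> R) (mu : {measure set X -> \bar R}) (s p : R) (u : X -> R)
  : Prop :=
  measurable_fun setT u /\ (Mnorm d mu s p u < +oo)%E.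

Definition Vol {dsp : measure_display} (X : measurableType dsp)
  (d : X -> X -> R) (mu : {measure set X -> \bar R}) (x y : X) : \bar R :=
  mu (mball d x (d x y)).

(** Besov integrand; on the diagonal (where it reads 0/0) it is set to 0 *)
Definition besov_integrand {dsp : measure_display} (X : measurableType dsp)
  (d : X -> X -> R) (mu : {measure set X -> \bar R}) (s p : R) (u : X -> R)
  (x y : X) : \bar R :=
  if pselect (x = y) then 0%E
  else ((powR `|u x - u y| p)%:E / ((powR (d x y) (s * p))%:E * Vol d mu x y))%E.

Definition Bnorm {dsp : measure_display} (X : measurableType dsp)
  (d : X -> X -> R) (mu : {measure set X -> \bar R}) (s p : R) (u : X -> R)
  : \bar R :=
  poweR (\int[mu]_x \int[mu]_y besov_integrand d mu s p u x y) p^-1.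

Definition Lp_loc {dsp : measure_display} (X : measurableType dsp)
  (d : X -> X -> R) (mu : {measure set X -> \bar R}) (p : R) (u : X -> R)
  : Prop :=
  measurable_fun setT u /\
  forall x (r : R), 0 < r ->
    (\int[mu]_(y in mball d x r) (powR `|u y| p)%:E < +oo)%E.

Definition in_Bdot {dsp : measure_display} (X : measurableType dsp)
  (d : X -> X -> R) (mu : {measure set X -> \bar R}) (s p : R) (u : X -> R)
  : Prop :=
  Lp_loc d mu p u /\ (Bnorm d mu s p u < +oo)%E.

End Defs.

(* Main.v *)
Require Import Defs.
From HB Require Import structures.
From mathcomp Require Import all_boot all_order all_algebra.
From mathcomp Require Import all_classical all_reals all_analysis measurable_realfun.
From mathcomp Require Import ring lra zify.
Set Implicit Arguments. Unset Strict Implicit. Unset Printing Implicit Defensive.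
Import Order.TTheory GRing.Theory Num.Theory.
Local Open Scope classical_set_scope.
Local Open Scope ring_scope.

(** Let p = n1/s1 = n2/s2 and pull mu_Y back to a measure nu on X.  Quasisymmetry
makes nu doubling on d_X-balls and gives
[d_Y(f z, f w)^n2 <= A * nu(B(z, d_X(z, w)))]; hence the Besov energy of u on Y
dominates the integral of [|U(z) - U(w)|^p / nu(B(z, d_X(z, w)))^2] for
nu x nu, where U = u o f.  The representative is the limsup of the nu-averages of
U over dyadic d_X-balls: telescoping these averages, with geometric weights on the
p-th power oscillations at the successive scales, yields a Hajlasz gradient at
every point.  By Tonelli and n1-regularity of mu_X, integrating the oscillation
over balls of radius r against mu_X costs a factor r^n1, which the weights
r^(-s1 p) cancel, and reverse doubling of nu sums the scales.  So the Hajlasz norm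
on X is controlled by the Besov norm on Y.  On a single regular space the Besov norm
is controlled by the Hajlasz norm, since balls of radius r
have volume at most C r^n; the four bounds combine these two estimates for f and for its inverse. *)

(** The obstacle is that [f] need not be absolutely continuous: nu and mu_X may be mutually
    singular, so the class of u o f modulo mu_X-null sets depends on the chosen representative of u,
    and what is known nu-almost everywhere says nothing mu_X-almost everywhere. Hence averages
    against nu, which see only the class of u and exist at every point, and a gradient inequality
    without exceptional set. The relation s p = n makes d^(s p) V comparable to d^(2n), so that the
    Besov energy becomes a double integral of |U(z) - U(w)|^p against a squared inverse volume, a
    quantity that quasisymmetry distorts only by constants. Regularity speaks only of radii below
    twice the diameter, which may be finite: radii are therefore tied to distances that occur,
    scales beyond the diameter are cut off, and the one-point space, where regularity is vacuous, is
    treated apart. *)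

(* [fubini_tonelli] wants a canonical sigma-finite structure, which a hypothesis on [mu]
cannot provide; the alias carries it. *)
Section sigma_finite_alias.
Context {R : realType} {d} {T : measurableType d} (mu : {measure set T -> \bar R}) (smu : sigma_finite setT mu).
Definition sigma_finite_copy of sigma_finite setT mu : set T -> \bar R := mu.
HB.instance Definition _ := Measure.copy (sigma_finite_copy smu) mu.
HB.instance Definition _ := Measure_isSigmaFinite.Build d T R (sigma_finite_copy smu) smu.
Definition sigma_finite_measure_of : {sigma_finite_measure set T -> \bar R} := sigma_finite_copy smu.
End sigma_finite_alias.

(** * Monotonicity of integrals, Tonelli, and sums over the integers *)

Section integrals_and_int_sums.
Context {R : realType}.

(** The integral of a nonnegative function is a supremum over the simple functions below it, and
    this set grows with the function. Besov integrals are compared this way without entering into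
    the measurability of their integrands. *)
Lemma ge0_le_integral_any {d} {T : measurableType d} (m : {measure set T -> \bar R})
  (f1 f2 : T -> \bar R) :
  (forall x, 0 <= f1 x)%E -> (forall x, f1 x <= f2 x)%E ->
  (\int[m]_x f1 x <= \int[m]_x f2 x)%E.
Proof.
move=> f10 f12.
have f20 x : (0 <= f2 x)%E by exact: le_trans (f12 x).
rewrite !ge0_integralTE//.
apply: ereal_sup_le => _ [h /= hf <-]; exists h => //= x.
exact: le_trans (hf x) (f12 x).
Qed.

Lemma tonelli {d1 d2} {T1 : measurableType d1} {T2 : measurableType d2}
  (m1 : {measure set T1 -> \bar R}) (m2 : {measure set T2 -> \bar R})
  (f : T1 -> T2 -> \bar R) :
  sigma_finite setT m1 -> sigma_finite setT m2 ->
  measurable_fun setT (fun z => f z.1 z.2) -> (forall x y, 0 <= f x y)%E ->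
  (\int[m1]_x \int[m2]_y f x y = \int[m2]_y \int[m1]_x f x y)%E.
Proof.
move=> s1 s2 mf f0.
exact: (@fubini_tonelli _ _ _ _ R (sigma_finite_measure_of s1) (sigma_finite_measure_of s2) (fun z => f z.1 z.2) mf (fun z => f0 z.1 z.2)).
Qed.

Lemma measurable_int_r {d1 d2} {T1 : measurableType d1} {T2 : measurableType d2}
  (m2 : {measure set T2 -> \bar R}) (f : T1 -> T2 -> \bar R) :
  sigma_finite setT m2 ->
  measurable_fun setT (fun z => f z.1 z.2) -> (forall x y, 0 <= f x y)%E ->
  measurable_fun setT (fun x => \int[m2]_y f x y)%E.
Proof.
move=> s2 mf f0.
exact: (@measurable_fun_fubini_tonelli_F _ _ _ _ R (sigma_finite_measure_of s2) (fun z => f z.1 z.2) mf (fun z => f0 z.1 z.2)).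
Qed.

(** [Mnorm] sums over all scales, that is over [int]; an enumeration turns such sums into series, to
    which monotone convergence and interchange apply. *)
Lemma int_bij_nat : exists e : nat -> int, set_bij [set: nat] [set: int] e.
Proof.
exists (fun n => if odd n then Negz n./2 else Posz n./2); split => //.
- move=> m n _ _ H; rewrite -(odd_double_half m) -(odd_double_half n); move: H.
  by case: (odd m); case: (odd n) => //= [] [->].
- move=> [m|m] _.
    by exists m.*2 => //; rewrite odd_double doubleK.
  by exists m.*2.+1 => //=; rewrite odd_double /= uphalf_double.
Qed.

Lemma esum_int_nneseries (e : nat -> int) (a : int -> \bar R) :
  set_bij [set: nat] [set: int] e -> (forall k, 0 <= a k)%E ->
  (esum [set: int] a = \sum_(i <oo) a (e i))%E.
Proof.
move=> be a0.
by rewrite (reindex_esum [set: nat] [set: int] e)// nneseries_esumT.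
Qed.

Lemma measurable_esum_int {d} {T : measurableType d} (F : int -> T -> \bar R) :
  (forall k, measurable_fun setT (F k)) -> (forall k x, 0 <= F k x)%E ->
  measurable_fun setT (fun x => esum [set: int] (F ^~ x)).
Proof.
move=> mF F0; have [e be] := int_bij_nat.
rewrite (_ : (fun _ => _) = (fun x => \sum_(i <oo) F (e i) x)%E).
  exact: ge0_emeasurable_sum.
by apply/funext => x; rewrite (esum_int_nneseries be).
Qed.

Lemma integral_esum_int {d} {T : measurableType d} (m : {measure set T -> \bar R})
  (F : int -> T -> \bar R) :
  (forall k, measurable_fun setT (F k)) -> (forall k x, 0 <= F k x)%E ->
  (\int[m]_x esum [set: int] (F ^~ x) = esum [set: int] (fun k => \int[m]_x F k x))%E.
Proof.
move=> mF F0; have [e be] := int_bij_nat.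
rewrite (esum_int_nneseries be); last by move=> k; exact: integral_ge0.
rewrite -integral_nneseries; [|by []|by move=> n; exact: mF|by move=> n x _; exact: F0].
by apply: eq_integral => x _; rewrite (esum_int_nneseries be).
Qed.

Lemma esum_intZl (c : R) (a : int -> \bar R) : 0 <= c -> (forall k, 0 <= a k)%E ->
  (esum [set: int] (fun k => c%:E * a k) = c%:E * esum [set: int] a)%E.
Proof.
move=> c0 a0; have [e be] := int_bij_nat.
rewrite !(esum_int_nneseries be)//; first by rewrite nneseriesZl.
by move=> k; rewrite mule_ge0.
Qed.

Lemma esum_int_nat_exchange (a : int -> nat -> \bar R) : (forall k i, 0 <= a k i)%E ->
  (esum [set: int] (fun k => \sum_(i <oo) a k i) =
   \sum_(i <oo) esum [set: int] (a ^~ i))%E.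
Proof.
move=> a0; have [e be] := int_bij_nat.
rewrite (esum_int_nneseries be); last by move=> k; exact: nneseries_ge0.
rewrite nneseries_interchange//.
by apply: eq_eseriesr => i _; rewrite (esum_int_nneseries be).
Qed.

Lemma esum_int_shift (c : int) (a : int -> \bar R) : (forall k, 0 <= a k)%E ->
  (esum [set: int] (fun k => a (k + c)%R) = esum [set: int] a)%E.
Proof.
move=> a0; rewrite [RHS](reindex_esum [set: int] [set: int] (fun k => k + c))//.
split => //; first by move=> x y _ _ /addIr.
by move=> y _; exists (y - c) => //; rewrite subrK.
Qed.

(* No convergence is needed: a tail bound on the sequence passes to its limsup. *)
Lemma limn_esup_close (a : nat -> R) (c M : R) (N : nat) :
  (forall i, (N <= i)%N -> `|a i - c| <= M) ->
  `|fine (limn_esup (fun i => (a i)%:E)) - c| <= M.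
Proof.
move=> H.
set l := limn_esup _.
have lub : (l <= (c + M)%:E)%E.
  rewrite /l limn_esup_lim; apply: lime_le; first exact: is_cvg_esups.
  near=> n; apply: ge_ereal_sup => _ [i /= ni <-].
  rewrite lee_fin; have : `|a i - c| <= M by apply: H; apply: leq_trans ni; near: n; exists N.
  by move=> /ler_normlP[]; lra.
have llb : ((c - M)%:E <= l)%E.
  rewrite /l limn_esup_lim; apply: lime_ge; first exact: is_cvg_esups.
  near=> n; apply: le_trans (ereal_sup_ubound _); last first.
    by exists n => //=.
  rewrite lee_fin; have : `|a n - c| <= M by apply: H; near: n; exists N.
  by move=> /ler_normlP[]; lra.
case: l lub llb => [r||]//=; rewrite !lee_fin => h1 h2.
by apply/ler_normlP; split; lra.
Unshelve. all: by end_near.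
Qed.
End integrals_and_int_sums.

(** * Dyadic scales, geometric series and averages *)

Section dyadic.
Context {R : realType}.

(** Stands in for a maximum that need not be attained. Regularity can only be used at radii
    controlled by a distance that occurs, and [q * h a] with q < 2 is such a radius when [h] is a
    distance. *)
Lemma near_sup (T : Type) (P : T -> Prop) (h : T -> R) (q M : R) (x0 : T) :
  1 < q -> P x0 -> 0 < h x0 -> (forall x, P x -> h x <= M) ->
  exists a, [/\ P a, 0 < h a & forall x, P x -> h x < q * h a].
Proof.
move=> q1 Px0 hx0 hM.
pose E : set R := [set h x | x in [set x | P x]].
have Eub : has_ubound E by exists M => _ [x Px <-]; exact: hM.
have Es : has_sup E by split=> //; exists (h x0); exists x0.
have s0 : 0 < sup E by apply: lt_le_trans hx0 _; apply: ub_le_sup => //; exists x0.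
have q0 : 0 < q by lra.
have e0 : 0 < sup E - sup E / q.
  by rewrite subr_gt0 ltr_pdivrMr// ltr_pMr.
have [_ [a Pa <-]] := sup_adherent e0 Es.
rewrite opprB addrC subrK => ha.
exists a; split => //.
  by apply: lt_trans ha; rewrite divr_gt0.
move=> x Px; apply: (@le_lt_trans _ _ (sup E)); first by apply: ub_le_sup => //; exists x.
by rewrite mulrC -ltr_pdivrMr.
Qed.

Definition dyad (k : int) : R := powR 2 (- k%:~R).

Lemma dyad_gt0 k : 0 < dyad k.
Proof. exact: powR_gt0. Qed.

Lemma dyadS k : dyad (k + 1) = dyad k / 2.
Proof.
by rewrite /dyad rmorphD/= opprD powRD ?powR_inv1//; apply/implyP => _; rewrite pnatr_eq0.
Qed.

Lemma dyadB1 k : dyad (k - 1) = 2 * dyad k.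
Proof. by rewrite -{2}(subrK 1 k) dyadS mulrC divfK// pnatr_eq0. Qed.

Lemma ler_dyad : {mono dyad : i j / i <= j >-> j <= i}.
Proof.
move=> i j; apply/idP/idP => [|ij]; last first.
  by rewrite ler_powR ?ler1n// lerN2 ler_int.
apply: contraTT; rewrite -!ltNge => ij.
rewrite /dyad !/powR; case: eqP => [/eqP|_]; first by rewrite pnatr_eq0.
rewrite ltr_expR ltr_pM2r; first by rewrite ltrN2 ltr_int.
by rewrite ln_gt0// ltr1n.
Qed.

Lemma dyad_subn (i : int) (n : nat) : dyad (i - n%:Z) = 2 ^+ n * dyad i.
Proof.
elim: n => [|n IH]; first by rewrite subr0 mul1r.
by rewrite intS (addrC 1) opprD addrA dyadB1 IH exprS mulrA.
Qed.

Lemma dyadic_scale (t : R) : 0 < t -> exists k, dyad (k + 1) <= t < dyad k.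
Proof.
move=> t0.
have l2 : 0 < ln (2 : R) by rewrite ln_gt0// ltr1n.
(* Here 2^F <= t < 2^(F+1), so [k + 1] must be [- F]. *)
pose F := Num.floor (ln t / ln 2); exists (- F - 1).
have := floor_itv (ln t / ln (2:R)); rewrite -/F => /andP[h1 h2].
rewrite subrK /dyad !/powR pnatr_eq0/=.
rewrite rmorphN /= opprK rmorphB rmorphN /= opprB opprK.
apply/andP; split.
  by rewrite -[leRHS](lnK t0) ler_expR -ler_pdivlMr.
rewrite -[ltLHS](lnK t0) ltr_expR -ltr_pdivrMr//.
by move: h2; rewrite rmorphD/= addrC.
Qed.

Lemma geometric_sum_le (t : R) (n : nat) : 0 <= t < 1 ->
  \sum_(0 <= i < n) t ^+ i <= (1 - t)^-1.
Proof.
move=> /andP[t0 t1]; have t1' : 0 < 1 - t by lra.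
rewrite -[leRHS]mul1r ler_pdivlMr// mulrC big_mkord -opprB mulNr -subrX1 opprB.
by rewrite gerBl exprn_ge0.
Qed.

Lemma nneseries_geometric_le (A t : R) (a : nat -> \bar R) : 0 <= A -> 0 <= t < 1 ->
  (forall i, 0 <= a i <= (A * t ^+ i)%:E)%E ->
  (\sum_(i <oo) a i <= (A / (1 - t))%:E)%E.
Proof.
move=> A0 t01 ha.
have a0 i : (0 <= a i)%E by have /andP[] := ha i.
apply: lime_le; first by apply: is_cvg_nneseries => *; exact: a0.
apply: nearW => n.
apply: (@le_trans _ _ (\sum_(0 <= i < n) (A * t ^+ i)%:E)%E).
  by apply: lee_sum => i _; have /andP[] := ha i.
by rewrite sumEFin lee_fin -mulr_sumr ler_wpM2l// geometric_sum_le.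
Qed.

Lemma esum_int_down (j0 : int) (a : int -> \bar R) : (forall j, 0 <= a j)%E ->
  (forall j, j0 < j -> a j = 0%E) ->
  (esum [set: int] a = \sum_(i <oo) a (j0 - i%:Z)%R)%E.
Proof.
move=> a0 aj.
rewrite (_ : esum [set: int] a = esum [set j | j <= j0] a); last first.
  rewrite [RHS]esum_mkcond; apply: eq_esum => j _.
  case: ifPn => // /negP; rewrite inE /= => /negP; rewrite -ltNge; exact: aj.
rewrite (reindex_esum [set: nat] [set j | j <= j0] (fun i => j0 - i%:Z))//.
  by rewrite nneseries_esumT.
split.
- by move=> i _ /=; rewrite gerBl.
- by move=> x y _ _ /addrI /oppr_inj [].
- move=> j /= jj0; exists `|j0 - j|%N => //.
  by rewrite gez0_abs ?subr_ge0// opprB addrC subrK.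
Qed.

(** The product is at most the p-th power of the larger of [l] and [t]. *)
Lemma powR_young (l t p : R) : 0 <= l -> 0 <= t -> 1 <= p ->
  l `^ (p - 1) * t <= l `^ p + t `^ p.
Proof.
move=> l0 t0 p1; have p0 : 0 < p by lra.
have [tl|lt] := leP t l.
  apply: (@le_trans _ _ (l `^ p)); last by rewrite lerDl powR_ge0.
  by rewrite -(mulr_powRB1 l0 p0) mulrC ler_wpM2r// powR_ge0.
apply: (@le_trans _ _ (t `^ p)); last by rewrite lerDr powR_ge0.
rewrite -(mulr_powRB1 t0 p0) mulrC ler_wpM2l//.
by apply: ge0_ler_powR; rewrite ?nnegrE//; [lra|exact: ltW].
Qed.

Lemma integrable_cst_fin {d} {T : measurableType d} (m : {measure set T -> \bar R})
  (A : set T) (c : R) : measurable A -> (m A < +oo)%E ->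
  m.-integrable A (EFin \o cst c).
Proof.
move=> mA mAoo; apply/integrableP; split; first exact/measurable_EFinP.
have -> : (\int[m]_(x in A) `|(EFin \o cst c) x| = \int[m]_(x in A) cst (`|c|%:E) x)%E.
  by apply: eq_integral.
by rewrite integral_cst// lte_mul_pinfty// lee_fin.
Qed.

Definition avg {d} {T : measurableType d} (m : {measure set T -> \bar R})
  (A : set T) (U : T -> R) : R := fine (\int[m]_(x in A) (U x)%:E)%E / fine (m A).

(* With [l := |avg - c| / 2], integrate [l^(p-1) |U - c| <= l^p + |U - c|^p]. *)
Lemma avg_jensen {d} {T : measurableType d} (m : {measure set T -> \bar R})
  (A : set T) (U : T -> R) (p c : R) :
  1 <= p -> measurable A -> (0 < m A < +oo)%E ->
  m.-integrable A (EFin \o U) ->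
  (((`|avg m A U - c| / 2) `^ p)%:E * m A <= \int[m]_(x in A) (`|U x - c| `^ p)%:E)%E.
Proof.
move=> p1 mA /andP[mA0 mAoo] iU.
have mU : measurable_fun A U by have /integrableP[/measurable_EFinP] := iU.
have mAf : m A \is a fin_num by rewrite ge0_fin_numE// ltW.
have ic : m.-integrable A (EFin \o cst c) by exact: integrable_cst_fin.
set l := _ / 2; have l0 : 0 <= l by rewrite divr_ge0.
have p0 : 0 < p by lra.
have mUc : measurable_fun A (fun x => U x - c) by exact: measurable_funB.
have mN : measurable_fun A (fun x => (`|U x - c|)%:E).
  by apply/measurable_EFinP; exact: measurableT_comp.
have mNp : measurable_fun A (fun x => (`|U x - c| `^ p)%:E).
  apply/measurable_EFinP; apply: (measurableT_comp (measurable_powR p)).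
  exact: measurableT_comp.
have h1 : ((2 * l)%:E * m A <= \int[m]_(x in A) (`|U x - c|)%:E)%E.
  have -> : ((2 * l)%:E * m A = `|\int[m]_(x in A) (U x - c)%:E|)%E.
    under eq_integral do rewrite EFinB.
    rewrite (integralB mA iU ic) (integral_cst _ mA c%:E).
    rewrite -(fineK mAf) -(fineK (integrable_fin_num mA iU)) -!EFinM -EFinB abse_EFin.
    congr EFin.
    have a0 : 0 < fine (m A) by rewrite fine_gt0// mA0.
    rewrite /l mulrCA divff ?pnatr_eq0// mulr1 /avg -{2}(gtr0_norm a0) -normrM.
    by rewrite mulrBl divfK// gt_eqF.
  apply: le_abse_integral => //; exact/measurable_EFinP.
have lp0 x : A x -> (0 <= cst (l `^ p)%:E x)%E by rewrite lee_fin powR_ge0.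
have h2 : ((l `^ (p - 1))%:E * \int[m]_(x in A) (`|U x - c|)%:E <=
    (l `^ p)%:E * m A + \int[m]_(x in A) (`|U x - c| `^ p)%:E)%E.
  rewrite -(integral_cst _ mA) -ge0_integralZl_EFin//; last exact: powR_ge0.
  rewrite -ge0_integralD//.
  apply: ge0_le_integral => //.
  - by move=> x _; rewrite -EFinM lee_fin mulr_ge0 ?powR_ge0.
  - exact: measurable_funeM.
  - by apply: emeasurable_funD.
  - by move=> x _; rewrite -EFinM -EFinD lee_fin powR_young.
have h3 : ((2 * l `^ p)%:E * m A <=
    (l `^ p)%:E * m A + \int[m]_(x in A) (`|U x - c| `^ p)%:E)%E.
  apply: le_trans h2; apply: le_trans (lee_wpmul2l _ h1); last first.
    by rewrite lee_fin powR_ge0.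
  by rewrite muleA -EFinM -(mulr_powRB1 l0 p0) mulrA [X in (_ <= X%:E * _)%E]mulrC.
move: h3; rewrite -(fineK mAf) -!EFinM.
case: (\int[m]_(x in A) _)%E => [r| |] //=.
- by rewrite -EFinD !lee_fin; lra.
- by move=> _; rewrite leey.
Qed.
End dyadic.

Lemma inv_truncnS_lt {R : realType} (e : R) : 0 < e ->
  (Num.truncn e^-1).+1%:R^-1 < e.
Proof.
move=> e0; rewrite -[ltRHS]invrK ltf_pV2 ?posrE ?invr_gt0//.
exact: truncnS_gt.
Qed.

(** * Balls, separability and joint measurability of the distance *)

Section metric.
Context {R : realType} {X : Type} (d : X -> X -> R).
Hypothesis dm : is_metric d.

Lemma metric_ge0 x y : 0 <= d x y. Proof. by case: dm. Qed.
Lemma metric_xx x : d x x = 0. Proof. by case: dm => _ h _ _; apply/h. Qed.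
Lemma metric_sym x y : d x y = d y x. Proof. by case: dm. Qed.
Lemma metric_tri x y z : d x z <= d x y + d y z. Proof. by case: dm. Qed.
Lemma metric_gt0 x y : x <> y -> 0 < d x y.
Proof.
move=> xy; rewrite lt_neqAle metric_ge0 andbT eq_sym; apply/eqP.
by case: dm => _ h _ _ /h.
Qed.

Lemma mball_open x r : metric_open d (mball d x r).
Proof.
move=> y; rewrite /mball /= => xy; exists (r - d x y); first by rewrite subr_gt0.
by rewrite /mball => z /= yz; apply: le_lt_trans (metric_tri x y z) _; lra.
Qed.

Lemma subset_mball x y r s : d x y + r <= s -> mball d y r `<=` mball d x s.
Proof. by rewrite /mball => h z /= yz; apply: le_lt_trans (metric_tri x y z) _; lra. Qed.

Lemma le_mball x r s : r <= s -> mball d x r `<=` mball d x s.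
Proof. by move=> rs; apply: subset_mball; rewrite metric_xx add0r. Qed.

End metric.

Section borel_metric.
Context {R : realType} {dsp : measure_display} {X : measurableType dsp} (d : X -> X -> R).
Hypothesis dm : is_metric d.
Hypothesis mE : @measurable _ X = <<s metric_open d >>.

Lemma measurable_metric_open A : metric_open d A -> measurable A.
Proof. by move=> oA; rewrite mE; exact: sub_sigma_algebra. Qed.

Lemma measurable_mball x r : measurable (mball d x r).
Proof. by apply: measurable_metric_open; exact: mball_open. Qed.

Lemma mball_sigma_finite (m : {measure set X -> \bar R}) (x0 : X) :
  (forall x r, 0 < r -> (m (mball d x r) < +oo)%E) -> sigma_finite setT m.
Proof.
move=> mfin; exists (fun n => mball d x0 n.+1%:R).
  apply/esym/seteqP; split => // x _.
  exists (Num.truncn (d x0 x)) => //.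
  by rewrite /mball /=; exact: truncnS_gt.
by move=> i; split; [exact: measurable_mball|exact: mfin].
Qed.

Section separable.
Variables (m : {measure set X -> \bar R}) (x0 : X).
Hypothesis mpos : forall x r, 0 < r -> (0 < m (mball d x r) < +oo)%E.

(** All these balls lie in one ball of finite mass, so K of them give K c at most that mass; an
    infinite [E] would allow every K. *)
Lemma disjoint_mballs_finite (e c M : R) (E : set X) : 0 < e -> 0 < c ->
  trivIset E (fun x => mball d x e) ->
  (forall x, E x -> d x0 x < M /\ (c%:E <= m (mball d x e))%E) -> finite_set E.
Proof.
move=> e0 c0 tE HE; apply: contrapT => infE.
have /infiniteP/pcard_leP[g] := infE.
have gE i : E (g i) by apply: funS.
have ginj : injective g by move=> i j; apply: (@inj _ _ setT); rewrite inE.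
have [M0|M0] := leP M 0.
  by have [h _] := HE _ (gE 0); have := metric_ge0 dm x0 (g 0); lra.
pose F i := mball d (g i) e.
have tF : trivIset setT F.
  by move=> i j _ _ /(tE _ _ (gE i) (gE j)) /ginj.
have mF i : measurable (F i) by exact: measurable_mball.
have sub : \bigcup_i F i `<=` mball d x0 (M + e).
  by move=> z [i _]; apply: (subset_mball dm); have [h _] := HE _ (gE i); lra.
have Me : 0 < M + e by lra.
have /andP[_ fin] := mpos x0 Me.
have key (K : nat) : ((K%:R * c)%:E <= m (mball d x0 (M + e)))%E.
  apply: (@le_trans _ _ (m (\bigcup_i F i))); last first.
    by apply: le_measure; rewrite ?inE//; [exact: bigcup_measurable|exact: measurable_mball].
  rewrite measure_bigcup//; apply: le_trans (nneseries_lim_ge K _); last by [].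
  apply: (@le_trans _ _ (\sum_(0 <= i < K | i \in [set: nat]) c%:E)%E); last first.
    by apply: lee_sum => i _; have [] := HE _ (gE i).
  rewrite (eq_bigl xpredT); last by move=> i; rewrite in_setT.
  by rewrite sumEFin sumr_const_nat subn0 mulr_natl.
have mf : m (mball d x0 (M + e)) \is a fin_num by rewrite ge0_fin_numE.
have := key (Num.truncn (fine (m (mball d x0 (M + e))) / c)).+1.
rewrite -(fineK mf) lee_fin leNgt => /negP; apply.
by rewrite -ltr_pdivrMr// truncnS_gt.
Qed.

(** Take the centres of a maximal disjoint family of balls of radius [e]. By maximality every such
    ball meets one of the family, so the centres are 2e-dense. Each centre lies within some k + 1 of
    [x0] and its ball has mass at least some 1 / (l + 1); for fixed k and l there are finitely
    many. *)
Lemma exists_countable_net (e : R) : 0 < e ->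
  exists2 E : set X, countable E & forall x, exists2 q, E q & d x q < 2 * e.
Proof.
move=> e0.
have [E [_ tE Emax]] := ex_maximal_disjoint_subcollection (fun x => mball d x e) setT.
exists E.
  have -> : E = \bigcup_(k in [set: nat]) \bigcup_(l in [set: nat])
      (E `&` [set x | d x0 x < k.+1%:R /\ ((l.+1%:R^-1)%:E <= m (mball d x e))%E]).
    apply/seteqP; split => [x Ex|x [k _ [l _ []]]//].
    have /andP[m0 moo] := mpos x e0.
    have mf : m (mball d x e) \is a fin_num by rewrite ge0_fin_numE.
    exists (Num.truncn (d x0 x)) => //; exists (Num.truncn (fine (m (mball d x e)))^-1) => //.
    split => //=; split; first exact: truncnS_gt.
    rewrite -(fineK mf) lee_fin invf_ple ?posrE//; first exact/ltW/truncnS_gt.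
    by rewrite fine_gt0// m0.
  apply: bigcup_countable => // k _; apply: bigcup_countable => // l _.
  apply: finite_set_countable.
  apply: (@disjoint_mballs_finite e (l.+1%:R^-1) k.+1%:R) => //.
    by apply: sub_trivIset tE => x [].
  by move=> x [_ []].
move=> x; have [Ex|nEx] := pselect (E x).
  by exists x => //; rewrite (metric_xx dm) mulr_gt0.
have EEx : E `<` E `|` [set x].
  by split=> [y|/(_ x) h]; [left|apply/nEx/h; right].
apply: contrapT => far; apply: (Emax _ EEx (@subsetT _ _)).
have far' y z : E y -> mball d x e z -> mball d y e z -> False.
  rewrite /mball /= => Ey xz yz; apply: far; exists y => //.
  by have := metric_tri dm x z y; rewrite (metric_sym dm z y); lra.
move=> y z; rewrite /setU /=.
move=> [Ey|->] [Ez|->] [w [yw zw]] //.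
- by apply: tE => //; exists w.
- by have := far' _ _ Ey zw yw.
- by have := far' _ _ Ez yw zw.
Qed.

Lemma exists_dense : exists Q : nat -> X, forall x e, 0 < e -> exists i, d x (Q i) < e.
Proof.
have hE (n : nat) : exists E : set X, countable E /\
    (forall x, exists2 q, E q & d x q < 2 * n.+1%:R^-1).
  have n0 : 0 < n.+1%:R^-1 :> R by rewrite invr_gt0.
  by have [E cE hE] := exists_countable_net n0; exists E.
have [E HE] := choice hE.
have : countable (\bigcup_n E n) by apply: bigcup_countable => // n _; exact: (HE n).1.
have ne : \bigcup_n E n !=set0 by have [_ /(_ x0)[q Eq _]] := HE 0; exists q, 0.
move=> /pfcard_geP[E0|[Q]]; first by rewrite E0 in ne; case: ne.
exists Q => x e e0.
pose n := Num.truncn (2 / e).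
have [_ /(_ x)[q Eq xq]] := HE n.
have [i _ Qi] : (Q @` setT) q by apply: surj; exists n.
exists i; rewrite Qi; apply: lt_trans xq _.
by rewrite ltr_pdivrMr// mulrC -ltr_pdivrMr// truncnS_gt.
Qed.

End separable.

(** Measurable sets of the product come from rectangles, so separability enters: d(x, y) < r exactly
    when some dense point q and some t = 1 / (n + 1) satisfy d(q, x) < t and d(q, y) < r - t. *)
Lemma measurable_dist (Q : nat -> X) : (forall x e, 0 < e -> exists i, d x (Q i) < e) ->
  measurable_fun setT (fun z : X * X => d z.1 z.2).
Proof.
move=> dQ.
apply: (measurability _ (RGenInftyO.measurableE R)) => //.
move=> _ [_ [r ->] <-].
rewrite setTI.
rewrite (_ : _ @^-1` _ = \bigcup_(i in [set: nat]) \bigcup_(n in [set: nat])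
   (mball d (Q i) (n.+1%:R^-1) `*` mball d (Q i) (r - n.+1%:R^-1))).
  apply: bigcupT_measurable => i; apply: bigcupT_measurable => k.
  by apply: measurableX; exact: measurable_mball.
apply/seteqP; split => [[x y]|[x y] [i _ [k _ []]]]; rewrite /mball /= in_itv /=.
  move=> xy; have e0 : 0 < (r - d x y) / 2 by lra.
  set n := Num.truncn ((r - d x y) / 2)^-1.
  have n0 : 0 < n.+1%:R^-1 :> R by rewrite invr_gt0.
  have [i xi] := dQ x _ n0; exists i => //; exists n => //=.
  have := inv_truncnS_lt e0; rewrite -/n => ne.
  rewrite (metric_sym dm (Q i) x); split => //.
  move: (n.+1%:R^-1) xi ne => t xi ne.
  by have := metric_tri dm (Q i) x y; rewrite (metric_sym dm (Q i) x); lra.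
move: (k.+1%:R^-1) => t.
by move=> h1 h2; have := metric_tri dm x (Q i) y; rewrite (metric_sym dm x (Q i)); lra.
Qed.
End borel_metric.

Lemma metric_continuous_measurable {R : realType} {d1 d2} {X : measurableType d1}
  {Y : measurableType d2} (dX : X -> X -> R) (dY : Y -> Y -> R) (f : X -> Y) :
  @measurable _ X = <<s metric_open dX >> ->
  @measurable _ Y = <<s metric_open dY >> ->
  metric_continuous dX dY f -> measurable_fun setT f.
Proof.
move=> mX mY cf; apply: (measurability _ mY) => _ [B oB <-].
rewrite setTI mX; apply: sub_sigma_algebra => x /= Bfx.
have [e e0 eB] := oB _ Bfx; have [del del0 h] := cf x e e0.
by exists del => // y xy; apply: eB; exact: h.
Qed.

(** [ahlfors_regular] with its constant exposed, because the constant enters later ones. It is also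
    used for the metric of the target pulled back to the source. *)
Definition ahlfors_with {R : realType} {dsp} {X : measurableType dsp} (d : X -> X -> R)
  (m : {measure set X -> \bar R}) (n C : R) : Prop :=
  forall x r, 0 < r -> lt_2diam d r ->
    ((C^-1 * r `^ n)%:E <= m (mball d x r))%E /\ (m (mball d x r) <= (C * r `^ n)%:E)%E.

Lemma divr_lt_double {R : realFieldType} (a H : R) : 0 < a -> 1 <= H -> a / H < 2 * a.
Proof. by move=> a0 H1; rewrite ltr_pdivrMr; nra. Qed.

(** * Regularity bounds beyond the admissible radii *)

Section ahlfors.
Context {R : realType} {dsp : measure_display} {X : measurableType dsp} (d : X -> X -> R).
Hypothesis dm : is_metric d.
Hypothesis mB : forall x r, measurable (mball d x r).
Variables (m : {measure set X -> \bar R}) (n C : R).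
Hypotheses (n0 : 0 < n) (C1 : 1 <= C) (hA : ahlfors_with d m n C).

(** For r at least twice the diameter, the whole space lies in a ball of admissible radius 3/2 d(a,
    b), with d(a, b) nearly the diameter, and this radius is at most r. *)
Lemma ahlfors_upper (x0 y0 : X) (z : X) (r : R) : x0 <> y0 -> 0 < r ->
  (m (mball d z r) <= (C * r `^ n)%:E)%E.
Proof.
have n0' := n0; have C1' := C1.
move=> xy0 r0; have [h|h] := pselect (lt_2diam d r); first exact: (hA _ r0 h).2.
have rd x y : 2 * d x y <= r by rewrite leNgt; apply/negP => ?; apply: h; exists x, y.
(* Any ratio strictly between 1 and 2 would do: above 1 the radius exceeds every distance, below 2
   it stays admissible. *)
have q1 : 1 < 3 / 2 :> R by lra.
have bd (w : X * X) : True -> d w.1 w.2 <= r.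
  by move=> _; have := rd w.1 w.2; have := metric_ge0 dm w.1 w.2; lra.
have [[a b] /= [_ ab0 hab]] :=
  @near_sup R _ _ (fun z => d z.1 z.2) _ _ (x0, y0) q1 I (metric_gt0 dm xy0) bd.
have r'0 : 0 < 3 / 2 * d a b by lra.
apply: (@le_trans _ _ (m (mball d z (3 / 2 * d a b)))).
  apply: le_measure; rewrite ?inE//.
  by move=> y _; exact: (hab (z, y)).
have r'd : lt_2diam d (3 / 2 * d a b) by exists a, b; move: (d a b) r'0 => t; lra.
have [_ h'] := hA z r'0 r'd; apply: le_trans h' _.
rewrite lee_fin; apply: ler_wpM2l; first by lra.
apply: ge0_ler_powR; rewrite ?nnegrE//; [lra|lra|lra|].
by have := rd a b; lra.
Qed.

(** The smaller radius r / T is at most an existing distance, hence admissible. *)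
Lemma ahlfors_lower (T : R) (x y : X) (z : X) (r : R) : 1 <= T -> 0 < r -> r <= T * d x y ->
  ((C^-1 * (r / T) `^ n)%:E <= m (mball d z r))%E.
Proof.
move=> T1 r0 rT; have rT0 : 0 < r / T by rewrite divr_gt0//; lra.
have rTd : r / T <= d x y by rewrite ler_pdivrMr 1?mulrC//; lra.
have rT2 : lt_2diam d (r / T) by exists x, y; move: (r / T) rT0 rTd => t; lra.
have [h _] := hA z rT0 rT2; apply: le_trans h _.
apply: le_measure; rewrite ?inE//; apply: le_mball => //.
by rewrite ler_pdivrMr; [rewrite ler_peMr// ltW|lra].
Qed.
End ahlfors.

(** Quasisymmetry without the gauge [eta]: one [H] for each ratio [T]. Both [f] and its inverse
    satisfy it, [rho] being the metric of the target pulled back to the source. *)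
Definition qs_control {R : realType} {X : Type} (d rho : X -> X -> R) : Prop :=
  forall T, exists2 H, 1 <= H &
    forall x a b, d x a <= T * d x b -> rho x a <= H * rho x b.

(** * Comparison of the two families of balls, and doubling *)

Section quasisymmetric_pullback.
Context {R : realType} {dsp : measure_display} {X : measurableType dsp} (d rho : X -> X -> R).
Hypotheses (dm : is_metric d) (rm : is_metric rho).
Hypothesis mB : forall x r, measurable (mball d x r).
Hypothesis mBr : forall x r, measurable (mball rho x r).
Variables (m : {measure set X -> \bar R}) (n C : R).
Hypotheses (n0 : 0 < n) (C1 : 1 <= C) (hA : ahlfors_with rho m n C).
Hypothesis (mpos : forall x r, 0 < r -> (0 < m (mball rho x r) < +oo)%E).
Hypothesis qs : qs_control d rho.

(** Fix y distinct from x. Points outside the [d]-ball have [rho]-distance at least rho(x, y) / H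
    from x, by T = d(x, y) / r; points inside it have at most H rho(x, y), by T = r / d(x, y). So
    the [d]-ball lies between two [rho]-balls. *)
Lemma qs_mball_finite (x0 y0 x : X) (r : R) : x0 <> y0 -> 0 < r ->
  (0 < m (mball d x r) < +oo)%E.
Proof.
move=> xy0 r0.
have [y xy] : exists y, x <> y.
  have [xx0|] := pselect (x = x0); last by exists x0.
  by exists y0; rewrite xx0.
have dxy := metric_gt0 dm xy; have rxy := metric_gt0 rm xy.
apply/andP; split.
  have [H H1 hH] := qs (d x y / r).
  have e0 : 0 < rho x y / H by rewrite divr_gt0//; lra.
  have /andP[h _] := mpos x e0; apply: lt_le_trans h _.
  apply: le_measure; rewrite ?inE// => b; rewrite /mball /= => xb.
  rewrite ltNge; apply/negP => rb.
  have : rho x y <= H * rho x b.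
    apply: hH; rewrite mulrAC -mulrA ler_pMr// ler_pdivlMr// mul1r//.
  by apply/negP; rewrite -ltNge mulrC -ltr_pdivlMr//; lra.
have [H H1 hH] := qs (r / d x y).
have e0 : 0 < H * rho x y + 1 by rewrite addr_gt0// mulr_gt0//; lra.
have /andP[_ h] := mpos x e0; apply: le_lt_trans h.
apply: le_measure; rewrite ?inE// => b; rewrite /mball /= => xb.
have := hH x b y; rewrite divfK ?gt_eqF// => /(_ (ltW xb)); lra.
Qed.

(** If the two balls differ, some b has r <= d(x, b) < 2r. Let a nearly maximise rho(x, .) on the
    larger ball. The larger ball lies in the [rho]-ball of radius 3/2 rho(x, a), and the smaller one
    contains that of radius rho(x, a) / H, since d(x, y) >= r forces d(x, a) <= 2 d(x, y).
    Regularity compares these two [rho]-balls. *)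
Lemma qs_doubling : exists2 D, 2 <= D & forall x r, 0 < r ->
  (m (mball d x (2 * r)) <= D%:E * m (mball d x r))%E.
Proof.
have n0' := n0; have C1' := C1.
have [H H1 hH] := qs 2.
have h32 : 0 < 3 / 2 * H by lra.
(* The radii differ by the factor 3/2 H, and each regularity bound costs one [C]; the maximum only
   ensures [2 <= D]. *)
exists (Num.max 2 (C * (3 / 2 * H) `^ n * C)); first by rewrite le_max lexx.
move=> x r r0.
have [sub|] := pselect (mball d x (2 * r) `<=` mball d x r).
  apply: (@le_trans _ _ (m (mball d x r))); first by apply: le_measure; rewrite ?inE.
  by rewrite -[leLHS]mul1e lee_wpmul2r// lee_fin le_max; apply/orP; left; lra.
move=> /existsNP[b /not_implyP[b2 nb]].
have {}b2 : d x b < 2 * r by [].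
have rb : r <= d x b by rewrite leNgt; apply/negP.
have xb : x <> b by move=> xb; move: rb; rewrite -xb metric_xx//; lra.
have q1 : 1 < 3 / 2 :> R by lra.
have bd a : d x a < 2 * r -> rho x a <= H * rho x b by move=> xa; apply: hH; lra.
have [a [xa ra0 ha]] :=
  @near_sup R X (fun a => is_true (d x a < 2 * r)) (rho x) _ _ b q1 b2 (metric_gt0 rm xb) bd.
have r1 : 0 < 3 / 2 * rho x a by lra.
have r2 : 0 < rho x a / H by rewrite divr_gt0//; lra.
have r2d : lt_2diam rho (rho x a / H).
  exists x, a; exact: divr_lt_double.
have r1d : lt_2diam rho (3 / 2 * rho x a) by exists x, a; lra.
have [_ up] := hA x r1 r1d.
have [lo _] := hA x r2 r2d.
apply: (@le_trans _ _ (m (mball rho x (3 / 2 * rho x a)))).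
  by apply: le_measure; rewrite ?inE// => y; exact: ha.
apply: (le_trans up).
apply: (@le_trans _ _ ((C * (3 / 2 * H) `^ n * C)%:E * m (mball rho x (rho x a / H)))%E).
  apply: le_trans (lee_wpmul2l _ lo); last first.
    by rewrite lee_fin !mulr_ge0 ?powR_ge0//; lra.
  rewrite -EFinM lee_fin.
  have -> : 3 / 2 * rho x a = (3 / 2 * H) * (rho x a / H).
    by rewrite -(mulrA (3 / 2)) (mulrC H) divfK// gt_eqF//; lra.
  rewrite (powRM n (ltW h32) (ltW r2)).
  rewrite -[leRHS]mulrA [X in _ <= _ * X]mulrA divff ?mul1r; last by rewrite gt_eqF//; lra.
  by rewrite mulrA.
apply: (@le_trans _ _ ((C * (3 / 2 * H) `^ n * C)%:E * m (mball d x r))%E).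
  apply: lee_wpmul2l; first by rewrite lee_fin !mulr_ge0 ?powR_ge0//; lra.
  apply: le_measure; rewrite ?inE// => y; rewrite /mball /= => xy.
  rewrite ltNge; apply/negP => ry.
  have : rho x a <= H * rho x y by apply: hH; lra.
  by apply/negP; rewrite -ltNge mulrC -ltr_pdivlMr//; lra.
by apply: lee_wpmul2r => //; rewrite lee_fin le_max lexx orbT.
Qed.

(** The [rho]-ball of radius rho(z, w) / H lies in the [d]-ball of radius d(z, w): a point y of it
    with d(z, y) >= d(z, w) would give rho(z, w) <= H rho(z, y). *)
Lemma qs_dist_le_mball : exists2 A, 1 <= A & forall z w, z <> w ->
  ((rho z w `^ n)%:E <= A%:E * m (mball d z (d z w)))%E.
Proof.
have n0' := n0; have C1' := C1.
have [H H1 hH] := qs 1.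
exists (C * H `^ n).
  have h : 1 <= H `^ n by rewrite -(powRr0 H) ler_powR// ltW.
  by rewrite -[leLHS]mul1r ler_pM.
move=> z w zw; have rzw := metric_gt0 rm zw.
have r2 : 0 < rho z w / H by rewrite divr_gt0//; lra.
have r2d : lt_2diam rho (rho z w / H).
  exists z, w; exact: divr_lt_double.
have [lo _] := hA z r2 r2d.
apply: (@le_trans _ _ ((C * H `^ n)%:E * m (mball rho z (rho z w / H)))%E).
  apply: le_trans (lee_wpmul2l _ lo); last by rewrite lee_fin mulr_ge0 ?powR_ge0//; lra.
  rewrite -EFinM lee_fin mulrACA divff ?mul1r; last by rewrite gt_eqF//; lra.
  by rewrite -powRM ?(ltW r2) ?(mulrC H) ?divfK// ?gt_eqF//; lra.
apply: lee_wpmul2l; first by rewrite lee_fin mulr_ge0 ?powR_ge0//; lra.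
apply: le_measure; rewrite ?inE// => y; rewrite /mball /= => zy.
rewrite ltNge; apply/negP => ry.
have : rho z w <= H * rho z y by apply: hH; lra.
by apply/negP; rewrite -ltNge mulrC -ltr_pdivlMr//; lra.
Qed.
End quasisymmetric_pullback.

Lemma bernoulli_le {R : realFieldType} (v : R) (k : nat) :
  1 <= v -> (v - 1) * k%:R <= v ^+ k - 1.
Proof.
move=> v1; elim: k => [|k IH]; first by rewrite mulr0 expr0 subrr.
have h : 1 <= v ^+ k by rewrite exprn_ege1.
rewrite exprS -[k.+1]addn1 natrD.
have : 0 <= (v ^+ k - 1) * (v - 1) by rewrite mulr_ge0 ?subr_ge0.
by move: (v ^+ k) (k%:R : R) IH h => u w IH h; lra.
Qed.

(** * Reverse doubling and the sum of inverse squared volumes *)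

Section doubling_volume.
Context {R : realType} {dsp : measure_display} {X : measurableType dsp} (d : X -> X -> R).
Hypothesis dm : is_metric d.
Hypothesis mE : @measurable _ X = <<s metric_open d >>.
Variable (nu : {measure set X -> \bar R}) (D : R).
Hypothesis nupos : forall x r, 0 < r -> (0 < nu (mball d x r) < +oo)%E.
Hypothesis D2 : 2 <= D.
Hypothesis hD : forall x r, 0 < r ->
  (nu (mball d x (2 * r)) <= D%:E * nu (mball d x r))%E.

Definition bvol (x : X) (r : R) : R := fine (nu (mball d x r)).

Lemma bvolE x r : 0 < r -> nu (mball d x r) = (bvol x r)%:E.
Proof. by move=> r0; rewrite fineK// ge0_fin_numE//; have /andP[] := nupos x r0. Qed.

Lemma bvol_gt0 x r : 0 < r -> 0 < bvol x r.
Proof. by move=> r0; rewrite -lte_fin -bvolE//; have /andP[] := nupos x r0. Qed.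

Lemma bvol_ge0 x r : 0 <= bvol x r.
Proof. by rewrite fine_ge0. Qed.

Lemma bvol_sub x y r s : 0 < r -> 0 < s -> d y x + r <= s -> bvol x r <= bvol y s.
Proof.
move=> r0 s0 h; rewrite -lee_fin -!bvolE//; apply: le_measure; rewrite ?inE.
- exact: measurable_mball.
- exact: measurable_mball.
- exact: subset_mball.
Qed.

Lemma bvol_le x r s : 0 < r -> r <= s -> bvol x r <= bvol x s.
Proof. by move=> r0 rs; apply: bvol_sub => //; rewrite ?metric_xx//; lra. Qed.

Lemma bvol2 x r : 0 < r -> bvol x (2 * r) <= D * bvol x r.
Proof.
move=> r0; rewrite -lee_fin EFinM -!bvolE//; last by rewrite mulr_gt0.
exact: hD.
Qed.

Lemma bvol2X x r k : 0 < r -> bvol x (2 ^+ k * r) <= D ^+ k * bvol x r.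
Proof.
have hD2 := D2; have D0 : 0 <= D by lra.
move=> r0; elim: k => [|k IH]; first by rewrite !expr0 !mul1r.
rewrite !exprS -!mulrA; apply: (le_trans (bvol2 x _)).
  by rewrite mulr_gt0// exprn_gt0.
by apply: ler_wpM2l.
Qed.

Variables (mu : {measure set X -> \bar R}) (n C : R) (x0 y0 : X).
Hypotheses (n0 : 0 < n) (C1 : 1 <= C) (hA : ahlfors_with d mu n C) (xy0 : x0 <> y0).

Lemma exists_pow2_gt (M : R) : exists k : nat, M < (2 `^ n) ^+ k.
Proof.
have a1 : 1 < 2 `^ n.
  have := @gt0_ltr_powR R n n0 1 2; rewrite powR1 !nnegrE; apply => //.
  by rewrite ltr1n.
pose b := 2 `^ n - 1; have b0 : 0 < b by rewrite subr_gt0.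
exists (Num.truncn (M / b)).+1.
have h (k : nat) : b * k%:R <= (2 `^ n) ^+ k - 1 by exact/bernoulli_le/ltW.
have := truncnS_gt (M / b); rewrite ltr_pdivrMr// mulrC => /lt_le_trans; apply.
by apply: le_trans (h _) _; rewrite gerBl.
Qed.

(** The factor 4 is chosen for the gradient estimate: two points at distance at least [dyad (k + 1)]
    bring the scale [dyad (k - 1)], four times larger, under this condition. *)
Definition below_diam (r : R) : Prop := exists x y, r <= 4 * d x y.

(** With an empty annulus, B(z, r/2) would equal a ball of the much smaller radius t = 2 r / 2^m up
    to inclusion, and the lower bound for one and the upper bound for the other would give 2^(n k)
    <= C^2. *)
Lemma annulus_point : exists2 m : nat, (2 <= m)%N & forall z r, 0 < r -> below_diam r ->
  exists2 x, d z x < r / 2 & 2 * (r / 2 ^+ m) <= d z x.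
Proof.
have n0' := n0; have C1' := C1.
have [k hk] := exists_pow2_gt (C * C).
(* With m = k + 4 one has r / 8 = 2^k t; the 8 is the halving of r times the loss T = 4 in
   [ahlfors_lower]. *)
exists k.+4 => // z r r0 [a [b rab]].
set t := 2 * (r / 2 ^+ k.+4).
have t0 : 0 < t by rewrite mulr_gt0// divr_gt0// exprn_gt0.
apply: contrapT => H.
have sub : mball d z (r / 2) `<=` mball d z t.
  move=> x zx; rewrite /mball /= ltNge; apply/negP => tx; apply: H; exists x => //.
have mB := measurable_mball dm mE.
have h1 : ((C^-1 * (r / 2 / 4) `^ n)%:E <= (C * t `^ n)%:E)%E.
  apply: (@le_trans _ _ (mu (mball d z (r / 2)))).
    have r2 : r / 2 <= 4 * d a b by lra.
    by apply: (ahlfors_lower dm mB hA z _ _ r2); lra.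
  apply: (@le_trans _ _ (mu (mball d z t))); first by apply: le_measure; rewrite ?inE.
  exact: (ahlfors_upper dm mB n0 C1 hA z xy0).
move: h1; rewrite lee_fin => h1.
have r8 : r / 2 / 4 = 2 ^+ k * t.
  rewrite /t !exprS; have : 2 ^+ k != 0 :> R by rewrite expf_neq0// pnatr_eq0.
  by move=> ?; field.
have k0 : 0 <= 2 ^+ k :> R by rewrite exprn_ge0.
have tn : 0 < t `^ n by rewrite powR_gt0.
rewrite r8 (powRM n k0 (ltW t0)) -powR_mulrn// powRAC powR_mulrn ?powR_ge0// in h1.
rewrite mulrA (ler_pM2r tn) in h1.
by move: h1; rewrite ler_pdivrMl; lra.
Qed.

(** Put t = r / 2^m. A point x of the annulus carries a ball of radius t that is disjoint from B(z,
    t) and inside B(z, r). As B(z, r) lies in B(x, 2r) and 2r = 2^(m+1) t, doubling gives this ball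
    at least the share D^-(m+1) of the mass, and B(z, t) gets at most the rest. *)
Lemma reverse_doubling : exists m theta, [/\ (0 < m)%N, 0 < theta < 1 &
  forall z r, 0 < r -> below_diam r -> bvol z (r / 2 ^+ m) <= theta * bvol z r].
Proof.
have D2' := D2.
have [m m2 hm] := annulus_point.
have Dm : 1 < D ^+ m.+1 by rewrite exprn_egt1//; lra.
exists m, (1 - (D ^+ m.+1)^-1); split; first by apply: leq_trans m2.
  have h1 : 0 < (D ^+ m.+1)^-1 by rewrite invr_gt0; lra.
  have h2 : (D ^+ m.+1)^-1 < 1 by rewrite invf_lt1//; lra.
  by apply/andP; split; lra.
move=> z r r0 rd; have [x zx1 zx2] := hm z r r0 rd.
set t := r / 2 ^+ m in zx2 *.
have t0 : 0 < t by rewrite divr_gt0// exprn_gt0.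
have tr : 2 * t <= r / 2.
  have m4 : 4 <= 2 ^+ m :> R.
    rewrite -(subnKC m2) exprD expr2; have : 1 <= 2 ^+ (m - 2) :> R by rewrite exprn_ege1// ler1n.
    by move: (2 ^+ (m - 2)) => u; lra.
  rewrite /t mulrA ler_pdivrMr ?exprn_gt0//.
  by move: (2 ^+ m) m4 => u u4; nra.
have big : bvol z r <= D ^+ m.+1 * bvol x t.
  apply: le_trans (bvol2X _ _ t0).
  have -> : 2 ^+ m.+1 * t = 2 * r.
    by rewrite /t exprS -mulrA (mulrC (2 ^+ m)) divfK// expf_neq0// pnatr_eq0.
  by apply: bvol_sub => //; [lra|rewrite (metric_sym dm); lra].
have disj : mball d z t `&` mball d x t = set0.
  apply/seteqP; split => // y []; rewrite /mball /= => zy xy.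
  by have := metric_tri dm z y x; rewrite (metric_sym dm y x); lra.
have un : bvol z t + bvol x t <= bvol z r.
  rewrite -lee_fin EFinD -!bvolE// -measureU//; try exact: measurable_mball.
  apply: le_measure; rewrite ?inE; [apply: measurableU| |]; try exact: measurable_mball.
  by move=> y [|]; apply: subset_mball => //; rewrite ?metric_xx//; lra.
have : (D ^+ m.+1)^-1 * bvol z r <= bvol x t by rewrite ler_pdivrMl//; lra.
lra.
Qed.

Definition small_scale (j : int) : Prop := below_diam (dyad j).

(* Cut off at scales beyond the diameter, where reverse doubling fails. *)
Definition inv_vol2 (j : int) (z : X) : R :=
  if `[< small_scale j >] then (bvol z (dyad j) ^+ 2)^-1 else 0.

Lemma inv_vol2_ge0 j z : 0 <= inv_vol2 j z.
Proof. by rewrite /inv_vol2; case: ifP => // _; rewrite invr_ge0 exprn_ge0// bvol_ge0. Qed.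

(** Passing to radii 2^m times larger multiplies the inverse squared volume by at most [th ^+ 2];
    strong induction in steps of m. *)
Lemma inv_vol2_geometric : exists A t, [/\ 0 < A, 0 < t < 1 &
  forall z j0 i, inv_vol2 (j0 - i%:Z) z <= A * t ^+ i * (bvol z (dyad j0) ^+ 2)^-1].
Proof.
have [m [th [m0 /andP[th0 th1] hth]]] := reverse_doubling.
(* The ratio per single scale, so that m scales give [th ^+ 2]. *)
pose t := (th ^+ 2) `^ (m%:R^-1).
have tm : t ^+ m = th ^+ 2.
  rewrite -powR_mulrn ?powR_ge0// /t -powRrM mulVf ?powRr1 ?exprn_ge0 ?ltW//.
  by rewrite pnatr_eq0 -lt0n.
have t0 : 0 < t by rewrite powR_gt0// exprn_gt0.
have t1 : t < 1.
  by rewrite -(@expr_lt1 _ m)// ?ltW// tm expr_lt1// ltW.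
(* The factor t^-m pays for the remaining fewer than m scales, where only monotonicity of the volume
   is used. *)
exists (t ^- m), t; split; [by rewrite invr_gt0 exprn_gt0|by rewrite t0|].
move=> z j0.
have tj (j : int) : 0 < bvol z (dyad j) ^+ 2 by rewrite exprn_gt0// bvol_gt0// dyad_gt0.
elim/ltn_ind => i IH.
rewrite /inv_vol2; case: asboolP => [[x [y al]]|_]; last first.
  by rewrite !mulr_ge0 ?invr_ge0 ?exprn_ge0 ?bvol_ge0// ltW.
have [im|mi] := ltnP i m.
  apply: (@le_trans _ _ (bvol z (dyad j0) ^+ 2)^-1).
    rewrite lef_pV2 ?posrE// ler_sqr ?nnegrE ?bvol_ge0//.
    by apply: bvol_le => //; rewrite ?dyad_gt0// ler_dyad gerBl.
  apply: ler_peMl; first by rewrite invr_ge0 exprn_ge0// bvol_ge0.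
  rewrite mulrC ler_pdivlMr ?exprn_gt0// mul1r.
  by apply: ler_wiXn2l; [exact: ltW|exact: ltW|exact: ltnW].
have e1 : dyad (j0 - (i - m)%N%:Z) = dyad (j0 - i%:Z) / 2 ^+ m :> R.
  have -> : j0 - i%:Z = j0 - (i - m)%N%:Z - m%:Z by rewrite -[in LHS](subnK mi) PoszD opprD addrA.
  by rewrite (dyad_subn _ m) mulrC mulKf// expf_neq0// pnatr_eq0.
have h := IH (i - m)%N (ltac:(by rewrite ltn_subLR// -[ltnLHS]add0n ltn_add2r)).
rewrite /inv_vol2 in h.
have al' : small_scale (j0 - (i - m)%N%:Z).
  exists x, y; apply: le_trans al; rewrite ler_dyad lerD2l lerN2 lez_nat leq_subr//.
move: h; case: asboolP => // _ h.
have := hth z (dyad (j0 - i%:Z)) (dyad_gt0 _) (ex_intro _ x (ex_intro _ y al)).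
rewrite -e1 => hv.
apply: (@le_trans _ _ (th ^+ 2 * (bvol z (dyad (j0 - (i - m)%N%:Z)) ^+ 2)^-1)).
  rewrite ler_pdivlMr// mulrC ler_pdivrMr// -exprMn.
  by rewrite ler_sqr ?nnegrE ?mulr_ge0 ?bvol_ge0// (ltW th0).
have -> : t ^- m * t ^+ i * (bvol z (dyad j0) ^+ 2)^-1 =
    th ^+ 2 * (t ^- m * t ^+ (i - m) * (bvol z (dyad j0) ^+ 2)^-1).
  by rewrite -tm -{1}(subnKC mi) exprD !mulrA; congr (_ * _ * _); rewrite mulrC.
by apply: ler_wpM2l h; rewrite exprn_ge0// ltW.
Qed.

(** If [dyad (k + 1) <= t < dyad k], only scales j <= k + 1 contribute. The sum is geometric,
    dominated by its finest scale, and one doubling compares [dyad (k + 1)] with t; [D] is squared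
    because the volume is. *)
Lemma sum_inv_vol2_le : exists2 A, 0 < A & forall z (t : R), 0 < t ->
  (esum [set: int] (fun j => if (t < dyad (j - 1))%R then (inv_vol2 j z)%:E else 0) <=
   (A * (bvol z t ^+ 2)^-1)%:E)%E.
Proof.
have [A [t [A0 /andP[t0 t1] h]]] := inv_vol2_geometric.
have D2' := D2.
have B0 : 0 < A / (1 - t) by rewrite divr_gt0// subr_gt0.
exists (A / (1 - t) * D ^+ 2); first by rewrite mulr_gt0// exprn_gt0//; lra.
move=> z s s0.
have [k /andP[ks sk]] := dyadic_scale s0.
rewrite (@esum_int_down _ (k + 1)); first last.
- move=> j kj; rewrite ifF//; apply/negbTE; rewrite -leNgt; apply: le_trans ks.
  by rewrite ler_dyad lerBrDr lezD1.
- by move=> j; case: ifP => // _; rewrite lee_fin inv_vol2_ge0.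
apply: (@le_trans _ _ (A * (bvol z (dyad (k + 1)) ^+ 2)^-1 / (1 - t))%:E).
  have Vk : 0 < (bvol z (dyad (k + 1)) ^+ 2)^-1.
    by rewrite invr_gt0 exprn_gt0// bvol_gt0// dyad_gt0.
  apply: nneseries_geometric_le; first by rewrite mulr_ge0// ltW.
    by rewrite ltW.
  move=> i; case: ifP => _; rewrite ?lee_fin ?inv_vol2_ge0//=.
    by rewrite mulrAC.
  by rewrite lexx !mulr_ge0// ?exprn_ge0// ltW.
rewrite lee_fin mulrAC -[leRHS]mulrA ler_wpM2l//; first exact: ltW.
rewrite ler_pdivlMr ?exprn_gt0 ?bvol_gt0// mulrC ler_pdivrMr ?exprn_gt0 ?bvol_gt0 ?dyad_gt0//.
rewrite -exprMn ler_sqr ?nnegrE ?mulr_ge0 ?bvol_ge0//; last by lra.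
apply: le_trans (bvol2 _ (dyad_gt0 _)).
by apply: bvol_le => //; rewrite dyadS mulrC divfK ?pnatr_eq0// ltW.
Qed.
End doubling_volume.

(** * Integrals of p-th powers of differences *)

Section power_integrals.
Context {R : realType}.

Lemma powR_add_le (a b p : R) : 0 <= a -> 0 <= b -> 0 <= p ->
  (a + b) `^ p <= 2 `^ p * (a `^ p + b `^ p).
Proof.
move=> a0 b0 p0.
wlog ab : a b a0 b0 / a <= b.
  move=> H; have [|/ltW] := leP a b; first exact: H.
  by rewrite addrC (addrC (_ `^ _)); exact: H.
apply: (@le_trans _ _ ((2 * b) `^ p)).
  by apply: ge0_ler_powR; rewrite ?nnegrE//; lra.
by rewrite powRM// ler_wpM2l ?powR_ge0// lerDr powR_ge0.
Qed.

Context {d : measure_display} {T : measurableType d}.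
Implicit Types (m : {measure set T -> \bar R}) (U : T -> R).

Lemma integral_if m (B : set T) (f : T -> \bar R) (b : T -> bool) :
  (forall x, b x <-> B x) ->
  (\int[m]_x (if b x then f x else 0) = \int[m]_(x in B) f x)%E.
Proof.
move=> bB; rewrite [RHS]integral_mkcond; apply: eq_integral => x _.
rewrite /patch; case: ifPn => [/bB|/negP] h; first by rewrite mem_set.
by rewrite memNset// => /bB.
Qed.

Lemma measurable_pow_dist (U : T -> R) (c p : R) : measurable_fun setT U ->
  measurable_fun setT (fun w => (`|c - U w| `^ p)%:E).
Proof.
move=> mU; apply/measurable_EFinP; apply: (measurableT_comp (measurable_powR p)).
by apply: measurableT_comp => //; exact: measurable_funB.
Qed.

Lemma measurable_pow_dist2 (U : T -> R) (p : R) : measurable_fun setT U ->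
  measurable_fun setT (fun z : T * T => (`|U z.1 - U z.2| `^ p)%:E).
Proof.
move=> mU; apply/measurable_EFinP; apply: (measurableT_comp (measurable_powR p)).
by apply: measurableT_comp => //; apply: measurable_funB; exact: measurableT_comp.
Qed.

(** As [B] has positive mass, the inner integral is finite for at least one z in [B]; then |U(w)| <=
    |U(z)| + |U(z) - U(w)|. *)
Lemma Lp_of_double m (B : set T) U (p : R) : 0 <= p -> measurable B ->
  (0 < m B < +oo)%E -> measurable_fun setT U ->
  (\int[m]_(z in B) \int[m]_(w in B) (`|U z - U w| `^ p)%:E < +oo)%E ->
  (\int[m]_(w in B) (`|U w| `^ p)%:E < +oo)%E.
Proof.
move=> p0 mB /andP[B0 Boo] mU dbl.
have [z Bz zoo] : exists2 z, B z & (\int[m]_(w in B) (`|U z - U w| `^ p)%:E < +oo)%E.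
  apply: contrapT => H.
  move: dbl; rewrite (_ : integral _ _ _ = (\int[m]_(z in B) cst +oo z)%E); last first.
    apply: eq_integral => z /set_mem Bz; apply/eqP; rewrite -leye_eq leNgt.
    by apply/negP => h; apply: H; exists z.
  by rewrite integral_cst// gt0_mulye// ltxx.
have mpz := measurable_pow_dist (U z) p mU.
have mpz' := measurable_funS (@measurableT _ T) (@subsetT _ B) mpz.
have m0B : measurable_fun B (fun w => (`|U w| `^ p)%:E).
  under eq_fun do rewrite -normrN -[X in `|X|]sub0r.
  exact: measurable_funS (measurable_pow_dist 0 p mU).
have c0 : 0 <= `|U z| `^ p by exact: powR_ge0.
apply: (@le_lt_trans _ _ (\int[m]_(w in B)
   ((2 `^ p)%:E * ((`|U z - U w| `^ p)%:E + cst (`|U z| `^ p)%:E w)))%E).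
  apply: ge0_le_integral => //.
  - apply: measurable_funeM; exact: emeasurable_funD.
  - move=> w _; rewrite -EFinD -EFinM lee_fin.
    apply: le_trans (powR_add_le _ _ p0) => //.
    apply: ge0_ler_powR; rewrite ?nnegrE ?addr_ge0//.
    by rewrite addrC; apply: le_trans (ler_normB (U z) (U z - U w)); rewrite subKr.
rewrite ge0_integralZl_EFin//; last 2 first.
- by move=> x _; rewrite -EFinD lee_fin addr_ge0.
- exact: emeasurable_funD.
rewrite ge0_integralD// integral_cst//.
rewrite lte_mul_pinfty ?lee_fin ?powR_ge0// lte_add_pinfty//.
by rewrite lte_mul_pinfty.
Qed.
End power_integrals.

Lemma nneseries_small {R : realType} (f : nat -> \bar R) (e : R) : 0 < e ->
  (forall i, 0 <= f i)%E -> (\sum_(i <oo) f i < +oo)%E ->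
  exists N, forall i, (N <= i)%N -> (f i <= e%:E)%E.
Proof.
move=> e0 f0 foo.
have /fine_cvgP[fin /cvgrPdist_le/(_ _ e0) h] := nneseries_tail_cvg foo (fun k _ => f0 k).
have [N _ H] := filterI fin h; exists N => i Ni.
have [tf] := H i Ni; rewrite sub0r normrN => /(le_trans (ler_norm _)) te.
apply: le_trans (_ : (\sum_(i <= k <oo) f k <= _)%E); last by rewrite -(fineK tf) lee_fin.
apply: le_trans (nneseries_lim_ge i.+1 _); last by move=> *; exact: f0.
by rewrite big_nat1.
Qed.

Lemma nneseries_le_esum_int {R : realType} (a : int -> \bar R) : (forall k, 0 <= a k)%E ->
  (\sum_(i <oo) a i%:Z <= esum [set: int] a)%E.
Proof.
move=> a0; rewrite nneseries_esumT; last by move=> n; exact: a0.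
rewrite -(@esum_image _ _ _ [set: nat] Posz a); last by move=> i j _ _ [].
rewrite (esumID (range Posz) setT)// setTI setTI leeDl//.
exact: esum_ge0.
Qed.

Lemma nneseries_ge_term {R : realType} (f : nat -> \bar R) (i : nat) :
  (forall i, 0 <= f i)%E -> (f i <= \sum_(i <oo) f i)%E.
Proof.
move=> f0; apply: le_trans (nneseries_lim_ge i.+1 _); last by move=> *; exact: f0.
by rewrite big_nat_recr//= leeDr// sume_ge0.
Qed.

Lemma powR_le_root {R : realType} (t c p : R) : 0 < p -> 0 <= t -> t `^ p <= c ->
  t <= c `^ p^-1.
Proof.
move=> p0 t0 h; have pN : p != 0 by rewrite gt_eqF.
rewrite -[leLHS](powRr1 t0) -(divff pN) powRrM.
apply: ge0_ler_powR; rewrite ?nnegrE ?invr_ge0 ?(ltW p0) ?powR_ge0//.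
exact: le_trans (powR_ge0 _ _) h.
Qed.

Lemma lez_absz_nat (k : int) (i : nat) : (absz k <= i)%N -> k <= i%:Z. Proof. lia. Qed.

Lemma absz_shift (k : int) (i : nat) : (absz k <= i)%N -> i%:Z = k + (absz (i%:Z - k))%:Z.
Proof. lia. Qed.

Lemma pred_shiftS (k : int) (i : nat) : k + i%:Z = k - 1 + i.+1%:Z. Proof. lia. Qed.

Lemma pred_le_shift (k : int) (i : nat) : k - 1 <= k + i%:Z. Proof. lia. Qed.

(** * From a finite nu-energy to a Hajlasz gradient with respect to mu *)

Section hajlasz_from_energy.
Context {R : realType} {dsp : measure_display} {X : measurableType dsp} (d : X -> X -> R).
Hypothesis dm : is_metric d.
Hypothesis mE : @measurable _ X = <<s metric_open d >>.
Variables (mu nu : {measure set X -> \bar R}) (n C D A p : R) (x0 y0 : X).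
Hypothesis mupos : forall x r, 0 < r -> (0 < mu (mball d x r) < +oo)%E.
Hypothesis nupos : forall x r, 0 < r -> (0 < nu (mball d x r) < +oo)%E.
Hypothesis D2 : 2 <= D.
Hypothesis hD : forall x r, 0 < r ->
  (nu (mball d x (2 * r)) <= D%:E * nu (mball d x r))%E.
Hypotheses (n0 : 0 < n) (C1 : 1 <= C) (hA : ahlfors_with d mu n C) (xy0 : x0 <> y0).
Hypothesis p1 : 1 < p.
Local Notation V := (bvol d nu).
Hypothesis A0 : 0 < A.
Hypothesis sumA : forall z (t : R), 0 < t ->
  (esum [set: int] (fun j => if (t < dyad (j - 1))%R then (inv_vol2 d nu j z)%:E else 0) <=
   (A * (V z t ^+ 2)^-1)%:E)%E.

Let p0 : 0 < p. Proof. exact: lt_trans ltr01 p1. Qed.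

Lemma sigma_finite_mu : sigma_finite setT mu.
Proof. by apply: (mball_sigma_finite dm mE x0) => x r /(mupos x)/andP[]. Qed.

Lemma sigma_finite_nu : sigma_finite setT nu.
Proof. by apply: (mball_sigma_finite dm mE x0) => x r /(nupos x)/andP[]. Qed.

Lemma measurable_distance : measurable_fun setT (fun z : X * X => d z.1 z.2).
Proof. by have [Q hQ] := exists_dense dm mE x0 mupos; exact: measurable_dist dm mE Q hQ. Qed.

Lemma measurable_if_close (F : X * X -> \bar R) (r : R) : measurable_fun setT F ->
  measurable_fun setT (fun z : X * X => if (d z.1 z.2 < r)%R then F z else 0%E).
Proof.
move=> mF; apply: measurable_fun_ifT => //.
by apply: measurable_fun_ltr => //; exact: measurable_distance.
Qed.

Lemma measurable_bvol r : 0 < r -> measurable_fun setT (V ^~ r).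
Proof.
move=> r0; apply/measurable_EFinP.
rewrite (_ : _ \o _ = fun z => (\int[nu]_w (if (d z w < r)%R then cst 1 (z, w) else 0))%E).
  apply: (measurable_int_r sigma_finite_nu).
    by apply: (measurable_if_close (F := cst 1%E)).
  by move=> x y; case: ifP.
apply/funext => z /=; rewrite -(bvolE nupos)//.
rewrite (@integral_if _ _ _ nu (mball d z r) (cst 1%E))// integral_cst ?mul1e//.
exact: measurable_mball.
Qed.

Lemma measurable_inv_vol2 j : measurable_fun setT (inv_vol2 d nu j).
Proof.
rewrite /inv_vol2; case: asboolP => // _.
rewrite (_ : (fun _ => _) = fun z => (V z (dyad j) ^+ 2) `^ (-1)).
  apply: (measurableT_comp (measurable_powR (-1))).
  by apply: measurable_funX; apply: measurable_bvol; exact: dyad_gt0.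
by apply/funext => z; rewrite powR_inv1// exprn_ge0// bvol_ge0.
Qed.

Variable (U : X -> R).
Hypothesis mU : measurable_fun setT U.

(** The radius [dyad (j - 1)] is twice [dyad j], so that it covers every ball of radius [dyad j]
    containing z. Integrated over such a ball it bounds, up to doubling constants, the double
    average of |U(z) - U(w)|^p there. *)
Definition osc_density (j : int) (z : X) : \bar R :=
  ((inv_vol2 d nu j z)%:E *
   \int[nu]_w (if (d z w < dyad (j - 1))%R then (`|U z - U w| `^ p)%:E else 0))%E.
Local Notation W := osc_density.

Lemma osc_density_ge0 j z : (0 <= W j z)%E.
Proof.
apply: mule_ge0; first by rewrite lee_fin inv_vol2_ge0.
by apply: integral_ge0 => w _; case: ifP => // _; rewrite lee_fin powR_ge0.
Qed.

Lemma measurable_osc_density j : measurable_fun setT (W j).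
Proof.
apply: emeasurable_funM; first by apply/measurable_EFinP; exact: measurable_inv_vol2.
apply: (measurable_int_r sigma_finite_nu).
  by apply: (measurable_if_close (F := fun z => (`|U z.1 - U z.2| `^ p)%:E)); exact: measurable_pow_dist2.
by move=> x y; case: ifP.
Qed.

Variable (kap : X -> X -> R).
Hypothesis mkap : measurable_fun setT (fun z : X * X => kap z.1 z.2).
Hypothesis kap0 : forall z w, 0 <= kap z w.
Hypothesis hkap : forall z w, z <> w -> (V z (d z w) ^+ 2)^-1 <= kap z w.

(** [kap] dominates the kernel V(z, d(z, w))^-2. It will be a multiple of a power of the pulled-back
    distance, whose joint measurability is immediate. *)
Definition energy : \bar R :=
  (\int[nu]_z \int[nu]_w (`|U z - U w| `^ p * kap z w)%:E)%E.

Lemma energy_integrand_measurable :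
  measurable_fun setT (fun z : X * X => (`|U z.1 - U z.2| `^ p * kap z.1 z.2)%:E).
Proof.
under eq_fun do rewrite EFinM.
by apply: emeasurable_funM; [exact: measurable_pow_dist2|exact/measurable_EFinP].
Qed.

Lemma energy_integrand_ge0 z w : (0 <= (`|U z - U w| `^ p * kap z w)%:E)%E.
Proof. by rewrite lee_fin mulr_ge0// powR_ge0. Qed.

(** After exchanging sum and integral, a fixed w collects [inv_vol2] over the scales with d(z, w) <
    [dyad (j - 1)]: this is the sum in [sumA] at t = d(z, w). On the diagonal the integrand
    vanishes. *)
Lemma sum_osc_density_le z : (esum [set: int] (W ^~ z) <=
  A%:E * \int[nu]_w (`|U z - U w| `^ p * kap z w)%:E)%E.
Proof.
have mz : measurable_fun setT (fun w => (`|U z - U w| `^ p * kap z w)%:E).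
  exact: (measurableT_comp energy_integrand_measurable (pair1_measurable z)).
have mj j : measurable_fun setT (fun w => if (d z w < dyad (j - 1))%R
    then (`|U z - U w| `^ p)%:E else 0%E).
  have h : measurable_fun setT (fun z : X * X => if (d z.1 z.2 < dyad (j - 1))%R
    then (`|U z.1 - U z.2| `^ p)%:E else 0%E).
    by apply: (measurable_if_close (F := fun z => (`|U z.1 - U z.2| `^ p)%:E)); exact: measurable_pow_dist2.
  exact: (measurableT_comp h (pair1_measurable z)).
have j0 j w : (0 <= if (d z w < dyad (j - 1))%R then (`|U z - U w| `^ p)%:E else 0)%E.
  by case: ifP => // _; rewrite lee_fin powR_ge0.
rewrite -(ge0_integralZl_EFin _ measurableT (fun w _ => energy_integrand_ge0 z w) mz (ltW A0)).
rewrite (_ : esum _ _ = esum [set: int] (fun j => \int[nu]_w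
    ((inv_vol2 d nu j z)%:E * (if (d z w < dyad (j - 1))%R then (`|U z - U w| `^ p)%:E else 0)))%E); last first.
  by apply: eq_esum => j _; rewrite ge0_integralZl_EFin// inv_vol2_ge0.
rewrite -integral_esum_int; last 2 first.
- by move=> j; exact: measurable_funeM.
- by move=> j w; rewrite mule_ge0// lee_fin inv_vol2_ge0.
apply: ge0_le_integral_any => w.
  by apply: esum_ge0 => j _; rewrite mule_ge0// lee_fin inv_vol2_ge0.
have [->|zw] := pselect (z = w).
  rewrite esum1.
    by rewrite subrr normr0 powR0 ?gt_eqF// mul0r mule0.
  by move=> j _; case: ifP => _; rewrite ?subrr ?normr0 ?powR0 ?gt_eqF// mule0.
apply: (@le_trans _ _ ((`|U z - U w| `^ p)%:E * (A * (V z (d z w) ^+ 2)^-1)%:E)%E).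
  apply: le_trans (lee_wpmul2l _ (sumA _ (metric_gt0 dm zw))); last by rewrite lee_fin powR_ge0.
  rewrite -esum_intZl ?powR_ge0//; last by move=> j; case: ifP => // _; rewrite lee_fin inv_vol2_ge0.
  apply: le_esum => j _; case: ifP => _; last by rewrite !mule0.
  by rewrite muleC.
rewrite -!EFinM lee_fin mulrCA ler_wpM2l ?(ltW A0)// ler_wpM2l ?powR_ge0//.
exact: hkap.
Qed.

Lemma sum_integral_osc_density_le :
  (esum [set: int] (fun j => \int[nu]_z W j z) <= A%:E * energy)%E.
Proof.
rewrite -integral_esum_int; [|exact: measurable_osc_density|exact: osc_density_ge0].
have me := measurable_int_r sigma_finite_nu energy_integrand_measurable energy_integrand_ge0.
have e0 z : setT z -> (0 <= \int[nu]_w (`|U z - U w| `^ p * kap z w)%:E)%E.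
  by move=> _; apply: integral_ge0 => w _; exact: energy_integrand_ge0.
rewrite /energy -(ge0_integralZl_EFin _ measurableT e0 me (ltW A0)).
apply: ge0_le_integral_any => z; last exact: sum_osc_density_le.
by apply: esum_ge0 => j _; exact: osc_density_ge0.
Qed.

(** The point x enters only through the ball, so this is meaningful at every x and may be integrated
    against [mu]. *)
Definition osc_mass (j : int) (x : X) : \bar R :=
  (\int[nu]_z (if (d x z < dyad j)%R then W j z else 0))%E.
Local Notation Phi := osc_mass.

Lemma osc_mass_ge0 j x : (0 <= Phi j x)%E.
Proof. by apply: integral_ge0 => z _; case: ifP => // _; exact: osc_density_ge0. Qed.

Lemma measurable_osc_close j :
  measurable_fun setT (fun z : X * X => if (d z.1 z.2 < dyad j)%R then W j z.2 else 0%E).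
Proof.
apply: (measurable_if_close (F := fun z => W j z.2)).
exact: (measurableT_comp (measurable_osc_density j)).
Qed.

Lemma measurable_osc_mass j : measurable_fun setT (Phi j).
Proof.
apply: (measurable_int_r sigma_finite_nu (measurable_osc_close j)).
by move=> x y; case: ifP => // _; exact: osc_density_ge0.
Qed.

(** Once the integrals are exchanged, z is counted with weight mu(B(z, [dyad j])). Here an integral
    against [mu] turns into one against [nu]. *)
Lemma integral_osc_mass_le j :
  (\int[mu]_x Phi j x <= (C * dyad j `^ n)%:E * \int[nu]_z W j z)%E.
Proof.
have mB := measurable_mball dm mE.
have c0 : 0 <= C * dyad j `^ n by rewrite mulr_ge0 ?powR_ge0// (le_trans ler01 C1).
rewrite /osc_mass (tonelli sigma_finite_mu sigma_finite_nu (measurable_osc_close j)); last first.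
  by move=> x y; case: ifP => // _; exact: osc_density_ge0.
rewrite -(ge0_integralZl_EFin _ measurableT (fun z _ => osc_density_ge0 j z) (measurable_osc_density j) c0).
apply: ge0_le_integral_any => z.
  by apply: integral_ge0 => x _; case: ifP => // _; exact: osc_density_ge0.
rewrite (@integral_if _ _ _ mu (mball d z (dyad j)) (cst (W j z))); last first.
  by move=> x; rewrite (metric_sym dm).
rewrite integral_cst// muleC lee_wpmul2r ?osc_density_ge0//.
exact: (ahlfors_upper dm mB n0 C1 hA z xy0 (dyad_gt0 j)).
Qed.

Hypothesis Efin : (energy < +oo)%E.

Lemma measurable_close_to x r : measurable_fun setT (fun w => d x w < r).
Proof.
apply: measurable_fun_ltr => //.
exact: (measurableT_comp measurable_distance (pair1_measurable x)).
Qed.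

(** For z, w in B(x, r) the ball B(z, d(z, w)) lies in B(x, 3r), so the kernel is at least V(x,
    3r)^-2. *)
Lemma energy_ball_fin x r : 0 < r ->
  (\int[nu]_(z in mball d x r) \int[nu]_(w in mball d x r) (`|U z - U w| `^ p)%:E < +oo)%E.
Proof.
move=> r0; have r30 : 0 < 3 * r by lra.
have V3 : 0 < V x (3 * r) ^+ 2 by rewrite exprn_gt0// (bvol_gt0 nupos).
set c := (V x (3 * r) ^+ 2)^-1; have c0 : 0 < c by rewrite invr_gt0.
have mB := measurable_mball dm mE x r.
pose h z := (\int[nu]_(w in mball d x r) (`|U z - U w| `^ p)%:E)%E.
have hE z : h z = (\int[nu]_w (if (d x w < r)%R then (`|U z - U w| `^ p)%:E else 0))%E.
  by rewrite (@integral_if _ _ _ nu (mball d x r) (fun w => (`|U z - U w| `^ p)%:E)).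
have h0 z : (0 <= h z)%E by apply: integral_ge0 => w _; rewrite lee_fin powR_ge0.
have mh : measurable_fun setT h.
  rewrite (_ : h = fun z => \int[nu]_w (if (d x w < r)%R then (`|U z - U w| `^ p)%:E else 0))%E; last exact/funext.
  apply: (measurable_int_r sigma_finite_nu); last first.
    by move=> z w; case: ifP => // _; rewrite lee_fin powR_ge0.
  apply: measurable_fun_ifT => //; last exact: measurable_pow_dist2.
  exact: (measurableT_comp (measurable_close_to x r) measurable_snd).
have le : (c%:E * \int[nu]_(z in mball d x r) h z <= energy)%E.
  rewrite -(ge0_integralZl_EFin _ mB (fun z _ => h0 z) (measurable_funS measurableT (@subsetT _ _) mh) (ltW c0)).
  rewrite -(@integral_if _ _ _ nu (mball d x r) (fun z => c%:E * h z)%E (fun z => d x z < r))//.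
  apply: ge0_le_integral_any => z.
    by case: ifP => // _; rewrite mule_ge0// lee_fin ltW.
  case: ifPn => xz; last by apply: integral_ge0 => w _; exact: energy_integrand_ge0.
  rewrite /h -ge0_integralZl_EFin//; last 2 first.
  - exact: measurable_funS (measurable_pow_dist (U z) p mU).
  - exact: ltW.
  rewrite -(@integral_if _ _ _ nu (mball d x r) (fun w => c%:E * (`|U z - U w| `^ p)%:E)%E (fun w => d x w < r))//.
  apply: ge0_le_integral_any => w.
    by case: ifP => // _; rewrite mule_ge0// lee_fin ?powR_ge0// ltW.
  case: ifPn => xw; last exact: energy_integrand_ge0.
  have [->|zw] := pselect (z = w); first by rewrite subrr normr0 powR0 ?gt_eqF// mul0r mule0.
  rewrite -EFinM lee_fin mulrC ler_wpM2l ?powR_ge0//.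
  apply: le_trans (hkap zw).
  have zw0 := metric_gt0 dm zw.
  rewrite lef_pV2 ?posrE ?exprn_gt0 ?(bvol_gt0 nupos)//.
  rewrite ler_sqr ?nnegrE ?bvol_ge0//; apply: (bvol_sub dm mE nupos) => //.
  by have := metric_tri dm z x w; rewrite (metric_sym dm z x); lra.
rewrite ltNge leye_eq; apply/negP => /eqP E.
by move: le; rewrite E gt0_muley// leye_eq => /eqP H; move: Efin; rewrite H ltxx.
Qed.

Lemma integrable_ball x r : 0 < r -> nu.-integrable (mball d x r) (EFin \o U).
Proof.
move=> r0; have mB := measurable_mball dm mE x r.
have mUB : measurable_fun (mball d x r) U by exact: measurable_funS mU.
have := Lp_of_double (ltW p0) mB (nupos x r0) mU (energy_ball_fin x r0) => h.
apply/integrableP; split; first exact/measurable_EFinP.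
have mN : measurable_fun (mball d x r) (fun w => (`|U w| `^ p)%:E).
  apply/measurable_EFinP; apply: (measurableT_comp (measurable_powR p)).
  exact: measurableT_comp.
apply: (@le_lt_trans _ _ (\int[nu]_(w in mball d x r) (cst 1%E w + (`|U w| `^ p)%:E))%E).
  apply: ge0_le_integral => //.
  - by do 2! apply: measurableT_comp => //.
  - exact: emeasurable_funD.
  - move=> w _ /=; rewrite -EFinD lee_fin.
    have := powR_young (ler01) (normr_ge0 (U w)) (ltW p1).
    by rewrite !powR1 mul1r.
rewrite ge0_integralD//= integral_cst// mul1e lte_add_pinfty//.
by have /andP[] := nupos x r0.
Qed.

(** [avg_jensen] is applied over [B] with the constant U(z), z in [B'], then over [B'] with the
    constant [a]. Each use costs 2^p, and D^2 replaces the volume about z by that about x. *)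
Lemma osc_mass_bound x j (B B' : set X) : small_scale d j ->
  measurable B -> measurable B' -> B `<=` mball d x (dyad j) -> B' `<=` mball d x (dyad j) ->
  (0 < nu B)%E -> (0 < nu B')%E ->
  ((`|avg nu B U - avg nu B' U| `^ p)%:E * nu B * nu B' <=
    (4 `^ p * D ^+ 2 * V x (dyad j) ^+ 2)%:E * Phi j x)%E.
Proof.
move=> sj mB mB' Bx B'x B0 B'0.
have xj := dyad_gt0 (R := R) j; set S := V x (dyad j).
have S0 : 0 < S by exact: (bvol_gt0 nupos).
have D0 : 0 < D by exact: lt_le_trans D2.
have mx := measurable_mball dm mE x (dyad j).
have fin (E : set X) : measurable E -> E `<=` mball d x (dyad j) -> (nu E < +oo)%E.
  move=> mE' Ex; have /andP[_] := nupos x xj; apply: le_lt_trans.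
  by apply: le_measure; rewrite ?inE.
have iB : nu.-integrable B (EFin \o U) by exact: integrableS (integrable_ball x xj).
have iB' : nu.-integrable B' (EFin \o U) by exact: integrableS (integrable_ball x xj).
have bf : nu B \is a fin_num by rewrite ge0_fin_numE// fin.
set a := avg nu B U; set a' := avg nu B' U.
pose I z := (\int[nu]_w (if (d z w < dyad (j - 1))%R then (`|U z - U w| `^ p)%:E else 0))%E.
have I0 z : (0 <= I z)%E.
  by apply: integral_ge0 => w _; case: ifP => // _; rewrite lee_fin powR_ge0.
have IW z : d x z < dyad j -> (I z <= (D ^+ 2 * S ^+ 2)%:E * W j z)%E.
  move=> xz; rewrite /osc_density /inv_vol2 asboolT// muleA -EFinM.
  rewrite -[leLHS]mul1e lee_wpmul2r// lee_fin.
  rewrite ler_pdivlMr ?exprn_gt0 ?(bvol_gt0 nupos)// mul1r -exprMn ler_sqr ?nnegrE ?bvol_ge0//; last first.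
    by rewrite mulr_ge0// ltW.
  apply: le_trans (bvol2 nupos hD x xj).
  by apply: (bvol_sub dm mE nupos) => //; [rewrite mulr_gt0|lra].
have claim1 z : d x z < dyad j ->
    ((`|U z - a| `^ p)%:E * nu B <= (2 `^ p * (D ^+ 2 * S ^+ 2))%:E * W j z)%E.
  move=> xz.
  have -> : `|U z - a| `^ p = 2 `^ p * (`|a - U z| / 2) `^ p.
    by rewrite -powRM ?divr_ge0// mulrC divfK ?pnatr_eq0// distrC.
  rewrite EFinM -muleA [in leRHS]EFinM -muleA lee_wpmul2l ?lee_fin ?powR_ge0//.
  apply: le_trans (IW z xz).
  apply: le_trans (avg_jensen _ (ltW p1) mB _ iB) _; first by rewrite B0 fin.
  rewrite -(@integral_if _ _ _ nu B (fun w => (`|U w - U z| `^ p)%:E) (fun w => w \in B)); last first.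
    by move=> w; rewrite in_setE.
  apply: ge0_le_integral_any => w; first by case: ifP => // _; rewrite lee_fin powR_ge0.
  case: ifPn => [/set_mem Bw|_]; last by case: ifP => // _; rewrite lee_fin powR_ge0.
  rewrite ifT; first by rewrite distrC.
  rewrite dyadB1; have xw : d x w < dyad j by exact: Bx.
  by have := metric_tri dm z x w; rewrite (metric_sym dm z x); lra.
have -> : `|a - a'| `^ p = 2 `^ p * (`|a' - a| / 2) `^ p.
  by rewrite -powRM ?divr_ge0// mulrC divfK ?pnatr_eq0// distrC.
have -> : 4 `^ p * D ^+ 2 * S ^+ 2 = 2 `^ p * (2 `^ p * (D ^+ 2 * S ^+ 2)).
  by rewrite (_ : 4 = 2 * 2 :> R) ?powRM ?mulrA//; lra.
rewrite EFinM -!muleA [in leRHS]EFinM -muleA lee_wpmul2l ?lee_fin ?powR_ge0//.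
rewrite (muleC (nu B)) muleA.
have W0 z : (0 <= (2 `^ p * (D ^+ 2 * S ^+ 2))%:E * W j z)%E.
  by rewrite mule_ge0 ?osc_density_ge0// lee_fin !mulr_ge0 ?powR_ge0 ?exprn_ge0// ltW.
apply: (@le_trans _ _ (\int[nu]_(z in B') (`|U z - a| `^ p)%:E * nu B)%E).
  by rewrite lee_wpmul2r// avg_jensen// ?ltW// B'0 fin.
have mUa : measurable_fun B' (fun z => (`|U z - a| `^ p)%:E).
  under eq_fun do rewrite distrC.
  exact: measurable_funS (measurable_pow_dist a p mU).
have Ua0 z : B' z -> (0 <= (`|U z - a| `^ p)%:E)%E by rewrite lee_fin powR_ge0.
rewrite muleC -(fineK bf) -(ge0_integralZl_EFin _ mB' Ua0 mUa) ?fine_ge0//.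
rewrite -(@integral_if _ _ _ nu B' (fun z => (fine (nu B))%:E * (`|U z - a| `^ p)%:E)%E (fun z => z \in B')); last first.
  by move=> z; rewrite in_setE.
have mc := measurableT_comp (measurable_osc_close j) (pair1_measurable x).
have w0 z : setT z -> (0 <= if (d x z < dyad j)%R then W j z else 0)%E.
  by move=> _; case: ifP => // _; exact: osc_density_ge0.
have c0 : 0 <= 2 `^ p * (D ^+ 2 * S ^+ 2).
  by rewrite !mulr_ge0 ?powR_ge0 ?exprn_ge0// ltW.
rewrite /osc_mass -(ge0_integralZl_EFin _ measurableT w0 mc c0).
apply: ge0_le_integral_any => z.
  by case: ifP => // _; rewrite mule_ge0// lee_fin ?powR_ge0// fine_ge0.
case: ifPn => [/set_mem B'z|_]; last first.
  by case: ifP => // _; rewrite mule0.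
have xz : d x z < dyad j by exact: B'x.
by rewrite xz muleC fineK//; exact: claim1.
Qed.

Definition ball_avg (j : int) (x : X) : R := avg nu (mball d x (dyad j)) U.
Local Notation a_ := ball_avg.
(** The first two factors come from [osc_mass_bound]; D^3 is the volume loss in [divide_mass],
    reached when two balls with different centres are compared. *)
Definition step_const : R := 4 `^ p * D ^+ 2 * D ^+ 3.

Let Dge1 : 1 <= D. Proof. by apply: le_trans D2; rewrite ler1n. Qed.
Let Dpos : 0 < D. Proof. exact: lt_le_trans ltr01 Dge1. Qed.

Lemma step_const_gt0 : 0 < step_const.
Proof. by rewrite !mulr_gt0 ?exprn_gt0 ?powR_gt0. Qed.

(** [b1] and [b2] are the masses of the two balls of averaging, [s] the squared mass of the ball
    containing both; [phi] may be infinite. *)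
Lemma divide_mass (t b1 b2 c s : R) (phi : \bar R) : 0 < b1 -> 0 < b2 -> 0 < c ->
  (0 <= phi)%E -> s <= D ^+ 3 * (b1 * b2) ->
  (t%:E * b1%:E * b2%:E <= (c * s)%:E * phi)%E -> (t%:E <= (c * D ^+ 3)%:E * phi)%E.
Proof.
move=> b10 b20 c0; have D3 : 0 < D ^+ 3 by rewrite exprn_gt0.
have k0 : (0 < (c * D ^+ 3)%:E)%E by rewrite lte_fin mulr_gt0.
case: phi => [r| |] r0 hs; [|by move=> _; rewrite (gt0_muley k0) leey|by []].
rewrite -!EFinM !lee_fin => h.
have b0 : 0 < b1 * b2 by rewrite mulr_gt0.
rewrite -(ler_pM2r b0) mulrA; apply: (le_trans h).
have cr : 0 <= c * r by rewrite mulr_ge0// ltW.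
have := ler_wpM2l cr hs; move: (D ^+ 3) => u; lra.
Qed.

Lemma ball_avg_step x j : small_scale d j ->
  ((`|a_ j x - a_ (j + 1) x| `^ p)%:E <= step_const%:E * Phi j x)%E.
Proof.
move=> sj; have xj := dyad_gt0 (R := R) j; have xj1 := dyad_gt0 (R := R) (j + 1).
have c0 : 0 < 4 `^ p * D ^+ 2 by rewrite mulr_gt0 ?exprn_gt0 ?powR_gt0.
have sub : mball d x (dyad (j + 1)) `<=` mball d x (dyad j).
  by apply: (le_mball dm); rewrite ler_dyad lerDl.
have mB r := measurable_mball dm mE x r.
have /andP[b0 _] := nupos x xj; have /andP[b1 _] := nupos x xj1.
have := osc_mass_bound sj (mB _) (mB _) (@subset_refl _ _) sub b0 b1.
rewrite !(bvolE nupos)//; apply: divide_mass => //.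
- exact: (bvol_gt0 nupos).
- exact: (bvol_gt0 nupos).
- exact: osc_mass_ge0.
have h := bvol2 nupos hD x xj1.
have e : dyad j = 2 * dyad (j + 1) :> R by rewrite dyadS mulrC divfK ?pnatr_eq0.
rewrite -e in h.
have V0 := bvol_gt0 nupos x xj.
rewrite expr2 mulrCA ler_wpM2l ?(ltW V0)//; apply: (le_trans h).
rewrite ler_wpM2r ?bvol_ge0// exprS ler_peMr ?(ltW Dpos)//.
by rewrite exprn_ege1.
Qed.

(** Both balls lie in B(x, 2 [dyad k]), hence the scale [k - 1]. Its volume is at most D times that
    of the ball about x and D^2 times that of the ball about y. *)
Lemma ball_avg_near x y k : small_scale d (k - 1) -> d x y < dyad k ->
  ((`|a_ k x - a_ k y| `^ p)%:E <= step_const%:E * Phi (k - 1) x)%E.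
Proof.
move=> sj xy; have xk := dyad_gt0 (R := R) k; have xk1 := dyad_gt0 (R := R) (k - 1).
have c0 : 0 < 4 `^ p * D ^+ 2 by rewrite mulr_gt0 ?exprn_gt0 ?powR_gt0.
have e : dyad (k - 1) = 2 * dyad k :> R by rewrite dyadB1.
have subx : mball d x (dyad k) `<=` mball d x (dyad (k - 1)).
  by apply: (subset_mball dm); rewrite metric_xx//; lra.
have suby : mball d y (dyad k) `<=` mball d x (dyad (k - 1)).
  by apply: (subset_mball dm); lra.
have mB z r := measurable_mball dm mE z r.
have /andP[b0 _] := nupos x xk; have /andP[b1 _] := nupos y xk.
have := osc_mass_bound sj (mB _ _) (mB _ _) subx suby b0 b1.
rewrite !(bvolE nupos)//; apply: divide_mass => //.
- exact: (bvol_gt0 nupos).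
- exact: (bvol_gt0 nupos).
- exact: osc_mass_ge0.
have h := bvol2 nupos hD x xk; rewrite -e in h.
have h2 : V x (dyad (k - 1)) <= D ^+ 2 * V y (dyad k).
  apply: le_trans (bvol2X nupos D2 hD y 2 xk).
  apply: (bvol_sub dm mE nupos) => //; first by rewrite mulr_gt0// exprn_gt0.
  by rewrite (metric_sym dm) e expr2; lra.
have -> : D ^+ 3 * (V x (dyad k) * V y (dyad k)) = (D * V x (dyad k)) * (D ^+ 2 * V y (dyad k)).
  by rewrite exprS; ring.
by rewrite expr2 ler_pM// bvol_ge0.
Qed.

Lemma measurable_ball_avg j : measurable_fun setT (a_ j).
Proof.
have xj := dyad_gt0 (R := R) j.
rewrite (_ : a_ j = fun x => fine (\int[nu]_(w in mball d x (dyad j)) (U w)%:E)%E * (V x (dyad j)) `^ (-1)); last first.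
  by apply/funext => x; rewrite powR_inv1 ?bvol_ge0.
apply: measurable_funM; last first.
  apply: (measurableT_comp (measurable_powR (-1))); exact: measurable_bvol.
apply: (measurableT_comp (@fine_measurable R _ measurableT)) => //.
have part (F : X -> \bar R) : measurable_fun setT F -> (forall w, 0 <= F w)%E ->
    measurable_fun setT (fun x => \int[nu]_(w in mball d x (dyad j)) F w)%E.
  move=> mF F0.
  rewrite [X in measurable_fun _ X](_ : _ = fun x =>
      (\int[nu]_w (if (d x w < dyad j)%R then F w else 0))%E); last first.
    by apply/funext => x; apply/esym; apply: integral_if.
  apply: (measurable_int_r sigma_finite_nu); last by move=> x w; case: ifP.
  apply: (measurable_if_close (F := fun z => F z.2)).
  exact: (measurableT_comp mF measurable_snd).
(* [U] has no sign, so Tonelli measurability is applied to its positive and negative parts. *)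
under eq_fun do rewrite integralE.
have mUe : measurable_fun setT (EFin \o U) by exact/measurable_EFinP.
by apply: emeasurable_funB; apply: part => //; [exact: measurable_funepos|exact: measurable_funeneg].
Qed.

(** The limsup exists without convergence, and [fine] sends infinite values to 0, so the function is
    real and total. *)
Definition representative (x : X) : R := fine (limn_esup (fun i : nat => (a_ i%:Z x)%:E)).

Lemma measurable_representative : measurable_fun setT representative.
Proof.
apply: (measurableT_comp (@fine_measurable R _ measurableT)) => //.
apply: (@measurable_fun_limn_esup _ _ _ _ (fun i x => (a_ i%:Z x)%:E)) => i.
by apply/measurable_EFinP; exact: measurable_ball_avg.
Qed.

Lemma sum_osc_density_fin_ae : {ae nu, forall z, (esum [set: int] (W ^~ z) < +oo)%E}.
Proof.
have e0 z : (0 <= esum [set: int] (W ^~ z))%E by apply: esum_ge0 => j _; exact: osc_density_ge0.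
have i : nu.-integrable setT (fun z => esum [set: int] (W ^~ z)).
  apply/integrableP; split.
    by apply: measurable_esum_int; [exact: measurable_osc_density|exact: osc_density_ge0].
  under eq_integral do rewrite gee0_abs//.
  rewrite integral_esum_int; [|exact: measurable_osc_density|exact: osc_density_ge0].
  apply: le_lt_trans sum_integral_osc_density_le _.
  by rewrite lte_mul_pinfty// lee_fin ltW.
have := integrable_ae measurableT i; apply: filterS => z /(_ I).
by rewrite ge0_fin_numE.
Qed.

Lemma eventually_small_scale : exists N : nat, forall i : nat, (N <= i)%N -> small_scale d i%:Z.
Proof.
have xy := metric_gt0 dm xy0.
have [k /andP[k1 _]] := dyadic_scale xy.
exists (absz (k + 1)) => i ki; exists x0, y0.
apply: (@le_trans _ _ (dyad (k + 1))); first by rewrite ler_dyad lez_absz_nat.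
by lra.
Qed.

(** A differentiation theorem by hand: finiteness of the sum makes [W i z] tend to 0, and
    [avg_jensen] with the constant U(z) bounds (|a_i(z) - U(z)| / 2)^p by the volume times
    [W i z]. *)
Lemma representative_eq z : (esum [set: int] (W ^~ z) < +oo)%E -> representative z = U z.
Proof.
move=> Woo; apply/eqP; rewrite -subr_eq0 -normr_le0; apply/ler_addgt0Pr => e e0.
rewrite add0r.
have [N1 hN1] := eventually_small_scale.
have V0 : 0 < V z (dyad 0) by rewrite (bvol_gt0 nupos)// dyad_gt0.
(* The volumes at scales i >= 0 are at most the one at scale 0, so this choice absorbs them. *)
pose e' := (e / 2) `^ p / V z (dyad 0).
have e'0 : 0 < e' by rewrite divr_gt0// powR_gt0// divr_gt0.
have [N2 hN2] := nneseries_small e'0 (fun i => osc_density_ge0 i%:Z z)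
  (le_lt_trans (nneseries_le_esum_int (fun i => osc_density_ge0 i z)) Woo).
apply: (@limn_esup_close _ _ _ _ (maxn N1 N2)) => i.
rewrite geq_max => /andP[/hN1 sj /hN2 Wi].
have xi := dyad_gt0 (R := R) i%:Z.
have mB := measurable_mball dm mE z (dyad i%:Z).
have Vi := bvol_gt0 nupos z xi.
have := avg_jensen (U z) (ltW p1) mB (nupos z xi) (integrable_ball z xi).
rewrite -/(a_ i z) (bvolE nupos)//.
have : (\int[nu]_(w in mball d z (dyad i)) (`|U w - U z| `^ p)%:E <= (V z (dyad i) ^+ 2 * e')%:E)%E.
  apply: (@le_trans _ _ ((V z (dyad i) ^+ 2)%:E * W i z)%E); last first.
    by rewrite [in leRHS]EFinM lee_wpmul2l// lee_fin exprn_ge0// ltW.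
  rewrite /osc_density /inv_vol2 asboolT// muleA -EFinM divff ?mul1e; last first.
    by rewrite gt_eqF// exprn_gt0.
  have -> : (\int[nu]_(w in mball d z (dyad i)) (`|U w - U z| `^ p)%:E =
      \int[nu]_w (if (d z w < dyad i)%R then (`|U w - U z| `^ p)%:E else 0))%E.
    by apply/esym; apply: integral_if.
  apply: ge0_le_integral_any => w; first by case: ifP => // _; rewrite lee_fin powR_ge0.
  case: ifPn => zw; last by case: ifP => // _; rewrite lee_fin powR_ge0.
  by rewrite ifT 1?distrC// dyadB1; lra.
move=> h1 h2; have := le_trans h2 h1; rewrite -EFinM lee_fin expr2 -mulrA mulrC ler_pM2l// => h3.
have : (`|a_ i z - U z| / 2) `^ p <= (e / 2) `^ p.
  apply: (le_trans h3); rewrite /e' mulrCA ler_piMr ?powR_ge0// ler_pdivrMr// mul1r.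
  by apply: (bvol_le dm mE nupos) => //; rewrite ler_dyad.
rewrite leNgt => h4; rewrite leNgt; apply/negP => h5; move/negP: h4; apply.
by apply: (gt0_ltr_powR p0); rewrite ?nnegrE ?divr_ge0 ?(ltW e0)// ltr_pM2r.
Qed.

Lemma representative_ae : {ae nu, forall z, representative z = U z}.
Proof. by have := sum_osc_density_fin_ae; apply: filterS => z; exact: representative_eq. Qed.

(* Any ratio in ]2^-n, 1[ works: below 1 the telescoped averages converge, above 2^-n
the weighted masses have a summable [mu]-integral. *)
Let q : R := 2 `^ (- (n / 2)).
Let q0 : 0 < q. Proof. exact: powR_gt0. Qed.
Let q1 : q < 1.
Proof.
rewrite /q powRN invf_lt1 ?powR_gt0//.
have n2 : 0 < n / 2 by exact: divr_gt0.
by have := @gt0_ltr_powR R _ n2 1 2; rewrite powR1; apply; rewrite ?nnegrE// ltr1n.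
Qed.
(** The ratio at which differences of successive averages decay, once p-th roots of the masses are
    taken. *)
Let tau : R := q `^ p^-1.
Let tau01 : 0 <= tau < 1.
Proof.
rewrite powR_ge0/=; have pV0 : 0 < p^-1 by rewrite invr_gt0.
by have := @gt0_ltr_powR R _ pV0 q 1; rewrite powR1; apply; rewrite ?nnegrE// ltW.
Qed.

(** The weights grow towards fine scales, so a finite value forces the masses to decay like q^i. The
    tail starts at [k - 1], the scale on which averages about two points at distance below [dyad k]
    are compared. *)
Definition osc_tail (k : int) (x : X) : \bar R :=
  (\sum_(i <oo) (q ^- i)%:E * Phi (k - 1 + i%:Z) x)%E.
Local Notation G := osc_tail.

Lemma osc_tail_term_ge0 k x i : (0 <= (q ^- i)%:E * Phi (k - 1 + i%:Z) x)%E.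
Proof. by rewrite mule_ge0 ?osc_mass_ge0// lee_fin invr_ge0 exprn_ge0// ltW. Qed.

Lemma osc_tail_ge0 k x : (0 <= G k x)%E.
Proof. by apply: nneseries_ge0 => i _ _; exact: osc_tail_term_ge0. Qed.

Lemma measurable_osc_tail k : measurable_fun setT (G k).
Proof.
apply: ge0_emeasurable_sum => [i x _ _|i _]; first exact: osc_tail_term_ge0.
by apply: measurable_funeM; exact: measurable_osc_mass.
Qed.

Lemma osc_mass_le_tail k x (g : R) i : G k x = g%:E ->
  (Phi (k - 1 + i%:Z) x <= (g * q ^+ i)%:E)%E.
Proof.
move=> Gg; have qi : 0 < q ^+ i by exact: exprn_gt0.
have := nneseries_ge_term i (osc_tail_term_ge0 k x); rewrite -/(G k x) Gg => h.
rewrite mulrC EFinM.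
have -> : Phi (k - 1 + i%:Z) x = ((q ^+ i)%:E * ((q ^- i)%:E * Phi (k - 1 + i%:Z) x))%E.
  by rewrite muleA -EFinM divff ?mul1e// gt_eqF.
by rewrite lee_wpmul2l// lee_fin ltW.
Qed.

(** Telescoping: the difference at scale k + i is at most the p-th root of a mass of order q^i, and
    these roots form a geometric series of ratio [tau]. *)
Lemma ball_avg_tail k x (g : R) (i : nat) : small_scale d (k - 1) -> G k x = g%:E ->
  `|a_ (k + i%:Z) x - a_ k x| <= (step_const * g) `^ p^-1 / (1 - tau).
Proof.
move=> sk Gg.
have g0 : 0 <= g by have := osc_tail_ge0 k x; rewrite Gg lee_fin.
have M0 : 0 <= (step_const * g) `^ p^-1 by exact: powR_ge0.
apply: (@le_trans _ _ ((step_const * g) `^ p^-1 * \sum_(0 <= l < i) tau ^+ l)); last first.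
  by apply: ler_wpM2l => //; exact: geometric_sum_le.
elim: i => [|i IH]; first by rewrite addr0 subrr normr0 big_nil mulr0.
rewrite big_nat_recr//= mulrDr.
have st : `|a_ (k + i%:Z) x - a_ (k + i%:Z + 1) x| <= (step_const * g) `^ p^-1 * tau ^+ i.
  have sj : small_scale d (k + i%:Z).
    by case: sk => x1 [y1 h]; exists x1, y1; apply: le_trans h; rewrite ler_dyad pred_le_shift.
  have := ball_avg_step x sj.
  (* The mass at scale k + i is the term i + 1 of the tail; the additional factor [tau] this yields
     is dropped below. *)
  rewrite [in X in (_ <= _ * X)%E]pred_shiftS.
  move=> /le_trans /(_ (lee_wpmul2l _ (osc_mass_le_tail i.+1 Gg))).
  rewrite -EFinM lee_fin ltW ?step_const_gt0// => /(_ isT).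
  rewrite lee_fin mulrA => /(powR_le_root p0 (normr_ge0 _)) h.
  apply: (le_trans h).
  have sg0 : 0 <= step_const * g by rewrite mulr_ge0// ltW// step_const_gt0.
  rewrite (powRM _ sg0); last by rewrite exprn_ge0// ltW.
  rewrite ler_wpM2l// -powR_mulrn ?(ltW q0)// powRAC powR_mulrn ?powR_ge0//.
  rewrite -/tau exprS; have /andP[t0 t1] := tau01.
  by rewrite ler_piMl ?exprn_ge0// ltW.
apply: le_trans (ler_distD (a_ (k + i%:Z) x) _ _) _; rewrite addrC.
apply: lerD; first exact: IH.
by rewrite distrC -[i.+1]addn1 PoszD addrA.
Qed.

Lemma representative_tail k x (g : R) : small_scale d (k - 1) -> G k x = g%:E ->
  `|representative x - a_ k x| <= (step_const * g) `^ p^-1 / (1 - tau).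
Proof.
move=> sk Gg; apply: (@limn_esup_close _ _ _ _ (absz k)) => i ki.
rewrite (absz_shift ki).
exact: ball_avg_tail.
Qed.

Variable s : R.
Hypotheses (s0 : 0 < s) (sp : s * p = n).

(** The series bounds the way from [representative] to the average at scale k, at x and at y; the
    added 1 pays for passing from one average to the other. *)
Definition grad_const : R := (1 - tau)^-1 + 1.
(** Since d(x, y) >= [dyad k] / 2, the factor 2^s makes d(x, y)^s times the weight at least
    [grad_const]. *)
Definition grad_weight (k : int) : R := grad_const * 2 `^ s * dyad k `^ (- s).
(** Where the tail diverges the value is +oo and the Hajlasz inequality is trivial. *)
Definition gradient (k : int) (x : X) : \bar R :=
  poweR ((step_const * grad_weight k `^ p)%:E * G k x)%E p^-1.

Lemma grad_const_ge0 : 0 <= grad_const.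
Proof. by rewrite addr_ge0// invr_ge0 subr_ge0; have /andP[_ /ltW] := tau01. Qed.

Lemma grad_weight_ge0 k : 0 <= grad_weight k.
Proof. by rewrite !mulr_ge0 ?powR_ge0 ?grad_const_ge0. Qed.

Lemma gradient_ge0 k x : (0 <= gradient k x)%E.
Proof. exact: poweR_ge0. Qed.

Lemma measurable_gradient k : measurable_fun setT (gradient k).
Proof.
apply: (measurableT_comp (measurable_poweR p^-1)).
by apply: measurable_funeM; exact: measurable_osc_tail.
Qed.

Lemma gradient_pow k x :
  poweR (gradient k x) p = ((step_const * grad_weight k `^ p)%:E * G k x)%E.
Proof.
rewrite /gradient -poweRrM mulVf ?gt_eqF// poweRe1// mule_ge0 ?osc_tail_ge0//.
by rewrite lee_fin mulr_ge0 ?powR_ge0// ltW// step_const_gt0.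
Qed.

Lemma gradient_fin k x (g : R) : G k x = g%:E ->
  gradient k x = ((step_const * g) `^ p^-1 * grad_weight k)%:E.
Proof.
move=> Gg; have g0 : 0 <= g by have := osc_tail_ge0 k x; rewrite Gg lee_fin.
have sg : 0 <= step_const * g by rewrite mulr_ge0// ltW// step_const_gt0.
rewrite /gradient Gg -EFinM poweR_EFin mulrAC (powRM _ sg) ?powR_ge0//.
by rewrite -[X in _ * X]powRrM divff ?gt_eqF// powRr1// grad_weight_ge0.
Qed.

Lemma gradient_pinfty k x : 0 < grad_weight k -> G k x = +oo%E -> gradient k x = +oo%E.
Proof.
move=> w0 Gx; rewrite /gradient Gx gt0_muley; last first.
  by rewrite lte_fin mulr_gt0 ?powR_gt0// step_const_gt0.
by rewrite poweRyr// invr_neq0// gt_eqF.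
Qed.

Lemma grad_weight_gt0 k : 0 < grad_weight k.
Proof.
rewrite !mulr_gt0 ?powR_gt0 ?dyad_gt0//.
by rewrite ltr_pwDr// invr_ge0 subr_ge0; have /andP[_ /ltW] := tau01.
Qed.

Lemma gradient_ineq k x y : dyad (k + 1) <= d x y < dyad k ->
  ((`|representative x - representative y|)%:E <=
    (d x y `^ s)%:E * (gradient k x + gradient k y))%E.
Proof.
move=> /andP[xy1 xy2].
have dk := dyad_gt0 (R := R) k; have dk1 := dyad_gt0 (R := R) (k + 1).
have d0 : 0 < d x y by exact: lt_le_trans xy1.
have ds0 : (0 < (d x y `^ s)%:E)%E by rewrite lte_fin powR_gt0.
have gy0 z : gradient k z != -oo%E by rewrite -ltNye (lt_le_trans _ (gradient_ge0 k z)).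
have sk : small_scale d (k - 1).
  exists x, y; rewrite dyadB1; move: xy1; rewrite dyadS; lra.
have Gfin z : (G k z = +oo%E) \/ exists g, G k z = g%:E.
  by have := osc_tail_ge0 k z; case: (G k z) => [g| |] // _; [right; exists g|left].
have [Gx|[g Gx]] := Gfin x.
  by rewrite (gradient_pinfty (grad_weight_gt0 k) Gx) addye// (gt0_muley ds0) leey.
have [Gy|[g' Gy]] := Gfin y.
  by rewrite (gradient_pinfty (grad_weight_gt0 k) Gy) addey// (gt0_muley ds0) leey.
rewrite (gradient_fin Gx) (gradient_fin Gy) -EFinD -EFinM lee_fin.
have h1 := representative_tail sk Gx; have h2 := representative_tail sk Gy.
have h3 : `|a_ k x - a_ k y| <= (step_const * g) `^ p^-1.
  apply: (powR_le_root p0 (normr_ge0 _)); rewrite -lee_fin.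
  apply: (le_trans (ball_avg_near sk xy2)).
  rewrite [in leRHS]EFinM lee_wpmul2l ?lee_fin ?(ltW step_const_gt0)//.
  by have := osc_mass_le_tail 0 Gx; rewrite addr0 expr0 mulr1.
set u := (step_const * g) `^ p^-1 in h1 h3 *; set u' := (step_const * g') `^ p^-1 in h2 *.
have u0 : 0 <= u by exact: powR_ge0.
have u'0 : 0 <= u' by exact: powR_ge0.
apply: (@le_trans _ _ (grad_const * (u + u'))).
  have h4 : `|representative x - representative y| <=
      `|representative x - a_ k x| + `|a_ k x - a_ k y| + `|representative y - a_ k y|.
    apply: le_trans (ler_distD (a_ k x) _ _) _; rewrite -addrA lerD2l.
    by apply: le_trans (ler_distD (a_ k y) _ _) _; rewrite lerD2l distrC.
  apply: (le_trans h4); rewrite /grad_const.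
  move: h1 h2 h3; move: `|_ - _| `|_ - _| `|_ - _| ((1 - tau)^-1) => m1 m2 m3 v.
  by move=> h1 h2 h3; lra.
rewrite -mulrDl mulrCA [leLHS]mulrC ler_wpM2l ?addr_ge0//.
rewrite /grad_weight.
have -> : d x y `^ s * (grad_const * 2 `^ s * dyad k `^ (- s)) =
    grad_const * (2 `^ s * d x y `^ s / dyad k `^ s) by rewrite powRN; ring.
rewrite ler_peMr ?grad_const_ge0// ler_pdivlMr ?powR_gt0// mul1r -powRM// ?(ltW d0)//.
apply: ge0_ler_powR; rewrite ?nnegrE ?(ltW s0) ?(ltW dk) ?mulr_ge0 ?(ltW d0)//.
by move: xy1; rewrite dyadS; lra.
Qed.

Lemma gradient_hajlasz : hajlasz_grad d mu s representative gradient.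
Proof.
split; first exact: measurable_gradient.
split; first exact: gradient_ge0.
(* The inequality holds for all pairs; an exceptional set negligible for [nu] might not be so for
   [mu]. *)
exists set0; split; first exact: negligible_set0.
move=> k x y _ _ h; apply: gradient_ineq.
by rewrite /dyad rmorphD/= opprD.
Qed.

(** q is the square root of 2^-n. One factor q^i will cancel the weight q^-i of [osc_tail], the
    other makes the series over i converge. *)
Lemma dyad_shift_powR (k : int) (i : nat) :
  dyad (k - 1 + i%:Z) `^ n = 2 `^ n * dyad k `^ n * (q ^+ i * q ^+ i).
Proof.
have -> : dyad (k - 1 + i%:Z) = 2 * dyad k * (2^-1) ^+ i :> R.
  have := @dyad_subn R (k - 1 + i%:Z) i; rewrite addrK dyadB1 => ->.
  by rewrite exprVn mulrAC divff ?mul1r// expf_neq0// pnatr_eq0.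
have h0 : 0 <= 2 * dyad k :> R by rewrite mulr_ge0// ltW// dyad_gt0.
rewrite (powRM _ h0) ?exprn_ge0 ?invr_ge0//; congr (_ * _).
  by rewrite powRM// ltW// dyad_gt0.
have h2 : 0 <= 2^-1 :> R by rewrite invr_ge0.
rewrite -(powR_mulrn i h2) powRAC powR_mulrn ?powR_ge0// -exprMn; congr (_ ^+ _).
rewrite /q -powRD; last by rewrite pnatr_eq0 implybT.
by rewrite -opprD -splitr powRN -powR_inv1// -powRrM mulN1r powRN.
Qed.

(** In order: the constants of [gradient], the regularity bound at radius [dyad (k - 1 + i)], the
    series over i, and the sum over scales from [sumA]. *)
Definition norm_const : R :=
  step_const * (grad_const * 2 `^ s) `^ p * C * 2 `^ n / (1 - q) * A.

Lemma grad_weight_pow k : grad_weight k `^ p = (grad_const * 2 `^ s) `^ p / dyad k `^ n.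
Proof.
rewrite /grad_weight powRM ?powR_ge0//; last by rewrite mulr_ge0 ?grad_const_ge0 ?powR_ge0.
by rewrite -[in X in _ * X = _]powRrM mulNr sp powRN.
Qed.

(** As s p = n, the p-th power of the weight carries [dyad k]^-n, which cancels the cost of
    [integral_osc_mass_le]. What remains depends on k only through the index of [W], so for each i
    the sum over k is a shift of the same sum S. *)
Lemma gradient_norm_le :
  (\int[mu]_x esum [set: int] (fun k => poweR (gradient k x) p) <= norm_const%:E * energy)%E.
Proof.
have C0 : 0 < C by exact: lt_le_trans ltr01 C1.
pose S := esum [set: int] (fun j => \int[nu]_z W j z)%E.
have w0 j : (0 <= \int[nu]_z W j z)%E by apply: integral_ge0 => z _; exact: osc_density_ge0.
have SA : (S <= A%:E * energy)%E by exact: sum_integral_osc_density_le.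
have S0 : (0 <= S)%E by exact: esum_ge0.
have Sfin : S \is a fin_num.
  by rewrite ge0_fin_numE//; apply: le_lt_trans SA _; rewrite lte_mul_pinfty// lee_fin ltW.
pose B := step_const * (grad_const * 2 `^ s) `^ p * C * 2 `^ n.
have B0 : 0 <= B.
  have sc0 := ltW step_const_gt0; rewrite mulr_ge0 ?powR_ge0//.
  by rewrite mulr_ge0 ?(ltW C0)// mulr_ge0 ?powR_ge0.
have gw0 k : 0 <= step_const * grad_weight k `^ p.
  by rewrite mulr_ge0 ?powR_ge0// ltW// step_const_gt0.
have term0 k x : (0 <= poweR (gradient k x) p)%E by exact: poweR_ge0.
have mg k : measurable_fun setT (fun x => poweR (gradient k x) p).
  exact: (measurableT_comp (measurable_poweR p) (measurable_gradient k)).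
rewrite (integral_esum_int _ mg term0).
have key k : (\int[mu]_x poweR (gradient k x) p <=
    \sum_(i <oo) (B * q ^+ i)%:E * \int[nu]_z W (k - 1 + i%:Z) z)%E.
  under eq_integral do rewrite gradient_pow.
  rewrite (ge0_integralZl_EFin _ measurableT (fun x _ => osc_tail_ge0 k x) (measurable_osc_tail k) (gw0 k)).
  rewrite /osc_tail integral_nneseries//; first last.
  - by move=> i x _; exact: osc_tail_term_ge0.
  - by move=> i; apply: measurable_funeM; exact: measurable_osc_mass.
  rewrite -nneseriesZl; last first.
    by move=> i _; apply: integral_ge0 => x _; exact: osc_tail_term_ge0.
  apply: lee_nneseries => i _.
    move=> _; rewrite mule_ge0 ?lee_fin//; apply: integral_ge0 => x _; exact: osc_tail_term_ge0.
  have qi : 0 < q ^+ i by rewrite exprn_gt0.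
  have qi' : 0 <= q ^- i by rewrite invr_ge0 ltW.
  rewrite (ge0_integralZl_EFin _ measurableT (fun x _ => osc_mass_ge0 _ x) (measurable_osc_mass _) qi').
  rewrite muleA -EFinM.
  apply: le_trans (lee_wpmul2l _ (integral_osc_mass_le _)) _; first by rewrite lee_fin mulr_ge0.
  rewrite muleA -EFinM dyad_shift_powR grad_weight_pow.
  suff -> : step_const * ((grad_const * 2 `^ s) `^ p / dyad k `^ n) / q ^+ i *
      (C * (2 `^ n * dyad k `^ n * (q ^+ i * q ^+ i))) = B * q ^+ i by [].
  have dn : dyad k `^ n != 0 by rewrite gt_eqF// powR_gt0// dyad_gt0.
  have qn : q ^+ i != 0 by rewrite gt_eqF.
  rewrite /B; move: (dyad k `^ n) dn (q ^+ i) qn (2 `^ n) ((grad_const * 2 `^ s) `^ p) step_const.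
  by move=> a an b bn c e t; field; apply/andP.
apply: (@le_trans _ _ (esum [set: int] (fun k =>
    \sum_(i <oo) (B * q ^+ i)%:E * \int[nu]_z W (k - 1 + i%:Z) z)%E)).
  by apply: le_esum => k _; exact: key.
have Bq i : 0 <= B * q ^+ i by rewrite mulr_ge0// exprn_ge0// ltW.
rewrite esum_int_nat_exchange; last by move=> k i; rewrite mule_ge0// lee_fin.
have inner i : (esum [set: int] (fun k => (B * q ^+ i)%:E * \int[nu]_z W (k - 1 + i%:Z) z) =
    (B * q ^+ i)%:E * S)%E.
  have sh := @esum_int_shift R (- 1 + i%:Z) (fun j => \int[nu]_z W j z)%E w0.
  have e1 := @esum_intZl R (B * q ^+ i) (fun k => \int[nu]_z W (k - 1 + i%:Z) z)%E
    (Bq i) (fun k => w0 (k - 1 + i%:Z)).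
  have e2 : (esum [set: int] (fun k => \int[nu]_z W (k - 1 + i%:Z) z) = S)%E.
    by apply: (eq_trans _ sh); apply: eq_esum => k _; rewrite addrA.
  by refine (eq_trans e1 _); clearbody S; rewrite e2.
under eq_eseriesr do rewrite inner.
apply: (@le_trans _ _ ((B / (1 - q))%:E * S)%E).
  rewrite -(fineK Sfin) -EFinM.
  have -> : B / (1 - q) * fine S = (B * fine S) / (1 - q) by rewrite mulrAC.
  apply: nneseries_geometric_le; first by rewrite mulr_ge0// fine_ge0.
    by rewrite (ltW q0) q1.
  move=> i; rewrite -EFinM !lee_fin mulrAC lexx andbT.
  exact: (mulr_ge0 (mulr_ge0 B0 (fine_ge0 S0)) (exprn_ge0 i (ltW q0))).
have B1 : 0 <= B / (1 - q) by rewrite divr_ge0// subr_ge0 ltW.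
apply: le_trans (lee_wpmul2l _ SA) _; first by rewrite lee_fin.
by rewrite muleA -EFinM.
Qed.

Lemma norm_const_gt0 : 0 < norm_const.
Proof.
have C0 : 0 < C by exact: lt_le_trans ltr01 C1.
rewrite !mulr_gt0 ?powR_gt0 ?step_const_gt0 ?invr_gt0 ?subr_gt0//.
rewrite mulr_gt0 ?powR_gt0//; apply: lt_le_trans ltr01 _.
by rewrite lerDr invr_ge0 subr_ge0; have /andP[_ /ltW] := tau01.
Qed.

Lemma Mnorm_representative_le :
  (Mnorm d mu s p representative <= poweR (norm_const%:E * energy) p^-1)%E.
Proof.
have pV0 : 0 <= p^-1 by rewrite invr_ge0 ltW.
have e0 : (0 <= energy)%E.
  by apply: integral_ge0 => z _; apply: integral_ge0 => w _; exact: energy_integrand_ge0.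
apply: (@le_trans _ _ (poweR (\int[mu]_x esum [set: int] (fun k => poweR (gradient k x) p)) p^-1)).
  by apply: ereal_inf_lbound; exists gradient => //; exact: gradient_hajlasz.
apply: (gt0_ler_poweR pV0); last exact: gradient_norm_le.
- rewrite in_itv/= leey andbT; apply: integral_ge0 => x _; apply: esum_ge0 => k _; exact: poweR_ge0.
- by rewrite in_itv/= leey andbT mule_ge0// lee_fin ltW// norm_const_gt0.
Qed.

End hajlasz_from_energy.

(** * Besov against Hajlasz norm on one regular space *)

Section besov.
Context {R : realType} {dsp : measure_display} {X : measurableType dsp} (d : X -> X -> R).
Hypothesis dm : is_metric d.
Hypothesis mE : @measurable _ X = <<s metric_open d >>.
Variables (mu : {measure set X -> \bar R}) (s p : R).
Hypothesis mupos : forall x r, 0 < r -> (0 < mu (mball d x r) < +oo)%E.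
Hypotheses (p0 : 0 < p) (s0 : 0 < s).

Lemma besov_integrandE (u : X -> R) x y : x <> y -> besov_integrand d mu s p u x y =
  (`|u x - u y| `^ p / (d x y `^ (s * p) * bvol d mu x (d x y)))%:E.
Proof.
move=> xy; have d0 := metric_gt0 dm xy; rewrite /besov_integrand; case: (pselect (x = y)) => [//|nxy].
rewrite /Vol (bvolE mupos)// -EFinM inver gt_eqF; first by rewrite -EFinM.
by rewrite mulr_gt0 ?powR_gt0 ?(bvol_gt0 mupos).
Qed.

Lemma besov_integrandxx (u : X -> R) x : besov_integrand d mu s p u x x = 0%E.
Proof. by rewrite /besov_integrand; case: pselect. Qed.

Lemma besov_integrand_ge0 (u : X -> R) x y : (0 <= besov_integrand d mu s p u x y)%E.
Proof.
have [->|xy] := pselect (x = y); first by rewrite besov_integrandxx.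
rewrite besov_integrandE// lee_fin divr_ge0 ?powR_ge0// mulr_ge0 ?powR_ge0//.
exact: bvol_ge0.
Qed.

Lemma Bnorm_pinfty (u : X -> R) : (Bnorm d mu s p u < +oo)%E ->
  (\int[mu]_x \int[mu]_y besov_integrand d mu s p u x y < +oo)%E.
Proof.
have pV : p^-1 != 0 by rewrite invr_neq0// gt_eqF.
exact: lty_poweRy.
Qed.

(** Within B(x, r) distances are below 2r and B(z, d(z, w)) lies in B(x, 3r), which bounds the Besov
    kernel below by a constant. *)
Lemma Lp_loc_of_Bnorm (u : X -> R) : measurable_fun setT u ->
  (Bnorm d mu s p u < +oo)%E -> Lp_loc d mu p u.
Proof.
move=> mU /Bnorm_pinfty Boo; split => // x r r0.
have mB := measurable_mball dm mE x r.
apply: (Lp_of_double (ltW p0) mB (mupos x r0) mU).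
have r30 : 0 < 3 * r by lra.
have V3 : 0 < bvol d mu x (3 * r) by rewrite (bvol_gt0 mupos).
have sp0 : 0 <= s * p by rewrite mulr_ge0 ?ltW.
set c := ((2 * r) `^ (s * p) * bvol d mu x (3 * r))^-1.
have r20 : 0 < 2 * r by lra.
have c0 : 0 < c by rewrite invr_gt0 mulr_gt0 ?powR_gt0.
have smu : sigma_finite setT mu.
  by apply: (mball_sigma_finite dm mE x) => z t /(mupos z)/andP[].
pose h z := (\int[mu]_(w in mball d x r) (`|u z - u w| `^ p)%:E)%E.
have hE z : h z = (\int[mu]_w (if (d x w < r)%R then (`|u z - u w| `^ p)%:E else 0))%E.
  by apply/esym; apply: integral_if.
have h0 z : (0 <= h z)%E by apply: integral_ge0 => w _; rewrite lee_fin powR_ge0.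
have mh : measurable_fun setT h.
  rewrite (_ : h = fun z => \int[mu]_w (if (d x w < r)%R then (`|u z - u w| `^ p)%:E else 0))%E; last exact/funext.
  apply: (measurable_int_r smu); last first.
    by move=> z w; case: ifP => // _; rewrite lee_fin powR_ge0.
  apply: measurable_fun_ifT => //; last exact: measurable_pow_dist2.
  exact: (measurableT_comp (measurable_close_to dm mE x mupos x r) measurable_snd).
have le : (c%:E * \int[mu]_(z in mball d x r) h z <=
    \int[mu]_x \int[mu]_y besov_integrand d mu s p u x y)%E.
  rewrite -(ge0_integralZl_EFin _ mB (fun z _ => h0 z) (measurable_funS measurableT (@subsetT _ _) mh) (ltW c0)).
  have -> : (\int[mu]_(z in mball d x r) (c%:E * h z) =
     \int[mu]_z (if (d x z < r)%R then c%:E * h z else 0))%E by apply/esym; apply: integral_if.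
  apply: ge0_le_integral_any => z.
    by case: ifP => // _; rewrite mule_ge0// lee_fin ltW.
  case: ifPn => xz; last by apply: integral_ge0 => w _; exact: besov_integrand_ge0.
  have g0 w : mball d x r w -> (0 <= (`|u z - u w| `^ p)%:E)%E by rewrite lee_fin powR_ge0.
  have mz := measurable_funS measurableT (@subsetT _ (mball d x r)) (measurable_pow_dist (u z) p mU).
  rewrite /h -(ge0_integralZl_EFin _ mB g0 mz (ltW c0)).
  have -> : (\int[mu]_(w in mball d x r) (c%:E * (`|u z - u w| `^ p)%:E) =
     \int[mu]_w (if (d x w < r)%R then c%:E * (`|u z - u w| `^ p)%:E else 0))%E.
    by apply/esym; apply: integral_if.
  apply: ge0_le_integral_any => w.
    by case: ifP => // _; rewrite mule_ge0// lee_fin ?powR_ge0// ltW.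
  case: ifPn => xw; last exact: besov_integrand_ge0.
  have [->|zw] := pselect (z = w).
    by rewrite subrr normr0 powR0 ?gt_eqF// mule0 besov_integrand_ge0.
  rewrite besov_integrandE// -EFinM lee_fin mulrC ler_wpM2l ?powR_ge0//.
  have zw0 := metric_gt0 dm zw.
  have zwr : d z w < 2 * r by have := metric_tri dm z x w; rewrite (metric_sym dm z x); lra.
  rewrite lef_pV2 ?posrE ?mulr_gt0 ?powR_gt0 ?(bvol_gt0 mupos)//.
  apply: ler_pM; rewrite ?powR_ge0 ?bvol_ge0//.
    by apply: ge0_ler_powR; rewrite ?nnegrE ?(ltW zw0) ?(ltW r20) ?(ltW zwr).
  by apply: (bvol_sub dm mE mupos) => //; lra.
rewrite ltNge leye_eq; apply/negP => /eqP E.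
by move: le; rewrite E gt0_muley// leye_eq => /eqP H; move: Boo; rewrite H ltxx.
Qed.

Variables (n C : R) (x0 y0 : X).
Hypotheses (n0 : 0 < n) (C1 : 1 <= C) (hA : ahlfors_with d mu n C) (xy0 : x0 <> y0).
Hypothesis sp : s * p = n.

(** The upper volume bound leaves a kernel depending on the distance alone: jointly measurable and
    easy to transport. *)
Lemma besov_integrand_lower (u : X -> R) x y :
  ((`|u x - u y| `^ p * (C^-1 * (d x y) `^ (- (n + n))))%:E <= besov_integrand d mu s p u x y)%E.
Proof.
have [->|xy] := pselect (x = y).
  by rewrite subrr normr0 powR0 ?gt_eqF// mul0r besov_integrandxx.
have d0 := metric_gt0 dm xy; have C0 := lt_le_trans ltr01 C1.
rewrite besov_integrandE// lee_fin ler_wpM2l ?powR_ge0// sp powRN -invfM.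
rewrite lef_pV2 ?posrE ?mulr_gt0 ?powR_gt0 ?(bvol_gt0 mupos)//.
rewrite powRD; last by apply/implyP => _; rewrite gt_eqF.
rewrite mulrCA ler_wpM2l ?powR_ge0// -lee_fin -(bvolE mupos)//.
exact: (ahlfors_upper dm (measurable_mball dm mE) n0 C1 hA x xy0 d0).
Qed.

(** By s p = n the powers d^(s p) cancel and 1 / V <= C d^-n remains; on the shell d >= [dyad k] /
    2, hence 2^n. *)
Lemma besov_integrand_upper (u : X -> R) x y (G : \bar R) (k : int) :
  dyad (k + 1) <= d x y < dyad k -> (0 <= G)%E ->
  ((`|u x - u y|)%:E <= (d x y `^ s)%:E * G)%E ->
  (besov_integrand d mu s p u x y <= (C * 2 `^ n * dyad k `^ (- n))%:E * poweR G p)%E.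
Proof.
move=> /andP[k1 k2] G0 h.
have d0 : 0 < d x y by apply: lt_le_trans k1; exact: dyad_gt0.
have xy : x <> y by move=> xy; move: d0; rewrite xy metric_xx// ltxx.
have C0 := lt_le_trans ltr01 C1; have dk := dyad_gt0 (R := R) k.
have c0 : 0 < C * 2 `^ n * dyad k `^ (- n) by rewrite !mulr_gt0 ?powR_gt0.
case: G G0 h => [g| |] // g0 h; last first.
  by rewrite poweRyr ?gt_eqF// gt0_muley ?leey// lte_fin.
rewrite besov_integrandE// poweR_EFin -EFinM lee_fin sp.
rewrite ler_pdivrMr ?mulr_gt0 ?powR_gt0 ?(bvol_gt0 mupos)//.
move: h; rewrite -EFinM !lee_fin => h; rewrite lee_fin in g0.
apply: (@le_trans _ _ ((d x y `^ s * g) `^ p)).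
  by apply: ge0_ler_powR; rewrite ?nnegrE ?(ltW p0) ?mulr_ge0 ?powR_ge0.
rewrite powRM ?powR_ge0// -powRrM sp.
have lo : 1 <= C * 2 `^ n * dyad k `^ (- n) * bvol d mu x (d x y).
  have := ahlfors_lower dm (measurable_mball dm mE) hA x (lexx 1) d0 (_ : d x y <= 1 * d x y).
  rewrite mul1r lexx divr1 (bvolE mupos)// lee_fin => /(_ isT) lo.
  apply: (@le_trans _ _ (C * 2 `^ n * dyad k `^ (- n) * (C^-1 * d x y `^ n))); last by rewrite ler_pM2l.
  have -> : C * 2 `^ n * dyad k `^ (- n) * (C^-1 * d x y `^ n) = 2 `^ n * d x y `^ n / dyad k `^ n.
    have C00 : C != 0 by rewrite gt_eqF.
    have D00 : dyad k `^ n != 0 by rewrite gt_eqF// powR_gt0.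
    rewrite powRN; move: (dyad k `^ n) D00 (2 `^ n) (d x y `^ n) => a a0 b c.
    by field; rewrite a0 C00.
  rewrite ler_pdivlMr ?powR_gt0// mul1r -powRM ?(ltW d0)//.
  apply: ge0_ler_powR; rewrite ?nnegrE ?(ltW n0) ?(ltW dk) ?mulr_ge0 ?(ltW d0)//.
  by move: k1; rewrite dyadS; lra.
have dn : 0 <= d x y `^ n by exact: powR_ge0.
have gp : 0 <= g `^ p by exact: powR_ge0.
have := ler_wpM2l (mulr_ge0 dn gp) lo; rewrite mulr1 => /le_trans; apply.
rewrite le_eqVlt; apply/orP; left; apply/eqP; ring.
Qed.

Lemma besov_sigma_finite : sigma_finite setT mu.
Proof. by apply: (mball_sigma_finite dm mE x0) => z t /(mupos z)/andP[]. Qed.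

Lemma integral_close_le (H : X -> \bar R) (r : R) : 0 < r ->
  measurable_fun setT H -> (forall x, 0 <= H x)%E ->
  (\int[mu]_x \int[mu]_y (if (d x y < r)%R then H x else 0) <=
   (C * r `^ n)%:E * \int[mu]_x H x)%E.
Proof.
move=> r0 mH H0; have mB := measurable_mball dm mE.
have c0 : 0 <= C * r `^ n by rewrite mulr_ge0 ?powR_ge0// (le_trans ler01 C1).
rewrite -(ge0_integralZl_EFin _ measurableT (fun x _ => H0 x) mH c0).
apply: ge0_le_integral_any => x.
  by apply: integral_ge0 => y _; case: ifP.
have -> : (\int[mu]_y (if (d x y < r)%R then H x else 0) = \int[mu]_(y in mball d x r) cst (H x) y)%E.
  exact: integral_if.
rewrite integral_cst// muleC lee_wpmul2r//.
exact: (ahlfors_upper dm mB n0 C1 hA x xy0 r0).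
Qed.

Lemma poweR_add_le (a b : \bar R) : (0 <= a)%E -> (0 <= b)%E ->
  (poweR (a + b) p <= (2 `^ p)%:E * (poweR a p + poweR b p))%E.
Proof.
have pN : p != 0 by rewrite gt_eqF.
have c0 : (0 < (2 `^ p)%:E)%E by rewrite lte_fin powR_gt0.
case: a b => [a| |] [b| |]// a0 b0.
- rewrite -EFinD !poweR_EFin -EFinD -EFinM lee_fin; apply: powR_add_le => //; exact: ltW.
- by rewrite (poweRyr pN) poweR_EFin addey// (gt0_muley c0) leey.
- by rewrite (poweRyr pN) poweR_EFin addye// (gt0_muley c0) leey.
- by rewrite (poweRyr pN) addye// (gt0_muley c0) leey.
Qed.

Lemma esum_int_ge_term (a : int -> \bar R) k : (a k <= esum [set: int] a)%E.
Proof.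
apply: esum_ge; exists [set k]; first by split => //; exact: finite_set1.
by rewrite fsbig_set1.
Qed.

Definition besov_const : R := 2 * (2 `^ p * (C * 2 `^ n) * C).

Lemma besov_const_gt0 : 0 < besov_const.
Proof.
have C0 := lt_le_trans ltr01 C1.
by rewrite !mulr_gt0 ?powR_gt0.
Qed.

Lemma besov_const_split (k : int) (c := 2 `^ p * (C * 2 `^ n) * dyad k `^ (- n)) :
  C * dyad k `^ n * c + C * dyad k `^ n * c = besov_const.
Proof.
have : dyad k `^ n != 0 by rewrite gt_eqF// powR_gt0// dyad_gt0.
rewrite /c /besov_const powRN; move: (dyad k `^ n) => a an.
by field.
Qed.

(** Every pair off the diagonal lies in one dyadic shell, where the integrand is at most c_k times
    the sum of the values of g_k^p at the two points. Integrating out one variable over a ball of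
    radius [dyad k] costs C [dyad k]^n, which cancels the power in c_k. *)
Lemma besov_integral_le (u : X -> R) (g : int -> X -> \bar R) : hajlasz_grad d mu s u g ->
  (\int[mu]_x \int[mu]_y besov_integrand d mu s p u x y <=
   besov_const%:E * \int[mu]_x esum [set: int] (fun k => poweR (g k x) p))%E.
Proof.
move=> [mg [g0 [E [[N [mN N0 EN]] hg]]]].
have C0 := lt_le_trans ltr01 C1.
pose gp k x := poweR (g k x) p.
have gp0 k x : (0 <= gp k x)%E by exact: poweR_ge0.
have mgp k : measurable_fun setT (gp k) by exact: (measurableT_comp (measurable_poweR p) (mg k)).
(* Adding +oo on the null set makes the pointwise bound hold everywhere and leaves the integral
   unchanged. *)
pose h k x := (gp k x + +oo * (\1_N x)%:E)%E.
have i0 x : (0 <= +oo * (\1_N x)%:E :> \bar R)%E by rewrite mule_ge0// lee_fin.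
have h0 k x : (0 <= h k x)%E by rewrite adde_ge0.
have mi : measurable_fun setT (fun x => +oo * (\1_N x)%:E : \bar R)%E.
  by apply: measurable_funeM; apply/measurable_EFinP; exact: measurable_indic.
have mh k : measurable_fun setT (h k) by exact: emeasurable_funD.
have hN k x : N x -> h k x = +oo%E.
  by move=> Nx; rewrite /h indicE mem_set// mule1 addey// -ltNye (lt_le_trans _ (gp0 k x)).
have hE k x : ~ N x -> h k x = gp k x.
  by move=> Nx; rewrite /h indicE memNset// mule0 adde0.
pose c k := 2 `^ p * (C * 2 `^ n) * dyad k `^ (- n).
have c0 k : 0 < c k by rewrite !mulr_gt0 ?powR_gt0 ?dyad_gt0.
have ck0 k : (0 < (c k)%:E)%E by rewrite lte_fin.
pose F k x y := (if (d x y < dyad k)%R then (c k)%:E * (h k x + h k y) else 0)%E.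
have F0 k x y : (0 <= F k x y)%E.
  by rewrite /F; case: ifP => // _; rewrite mule_ge0 ?adde_ge0// ltW.
have mF k : measurable_fun setT (fun z : X * X => F k z.1 z.2).
  apply: (measurable_if_close dm mE x0 mupos (F := fun z => ((c k)%:E * (h k z.1 + h k z.2))%E)).
  apply: measurable_funeM; apply: emeasurable_funD; exact: measurableT_comp.
have ptw x y : (besov_integrand d mu s p u x y <= esum [set: int] (fun k => F k x y))%E.
  have [->|xy] := pselect (x = y); first by rewrite besov_integrandxx; apply: esum_ge0 => k _.
  have [k kd] := dyadic_scale (metric_gt0 dm xy).
  apply: le_trans (esum_int_ge_term _ k); rewrite /F; move: (kd) => /andP[kd1 ->].
  have [Nx|nNx] := pselect (N x).
    rewrite (hN k x Nx) addye ?(gt0_muley (ck0 k)) ?leey// -ltNye.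
    by rewrite (lt_le_trans _ (h0 k y)).
  have [Ny|nNy] := pselect (N y).
    rewrite (hN k y Ny) addey ?(gt0_muley (ck0 k)) ?leey// -ltNye.
    by rewrite (lt_le_trans _ (h0 k x)).
  have nEx : ~ E x by move/EN.
  have nEy : ~ E y by move/EN.
  have := hg k x y nEx nEy; rewrite {1}/dyad in kd1.
  have -> : 2 `^ (- k%:~R - 1) = dyad (k + 1) :> R by rewrite /dyad rmorphD/= opprD.
  move=> /(_ kd) /(besov_integrand_upper kd (adde_ge0 (g0 k x) (g0 k y))) /le_trans; apply.
  rewrite !hE//; apply: (@le_trans _ _ ((C * 2 `^ n * dyad k `^ (- n))%:E *
      ((2 `^ p)%:E * (gp k x + gp k y)))%E).
    apply: lee_wpmul2l; last exact: poweR_add_le.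
    by rewrite lee_fin !mulr_ge0 ?powR_ge0// ltW.
  by rewrite muleA -EFinM /c mulrC !mulrA.
apply: (@le_trans _ _ (\int[mu]_x \int[mu]_y esum [set: int] (fun k => F k x y))%E).
  apply: ge0_le_integral_any => x; first by apply: integral_ge0 => y _; exact: besov_integrand_ge0.
  by apply: ge0_le_integral_any => y; [exact: besov_integrand_ge0|exact: ptw].
have smu := besov_sigma_finite.
have mFx k x : measurable_fun setT (F k x) by exact: (measurableT_comp (mF k) (pair1_measurable x)).
have mIF k : measurable_fun setT (fun x => \int[mu]_y F k x y)%E.
  exact: (measurable_int_r smu (mF k) (F0 k)).
have IF0 k x : (0 <= \int[mu]_y F k x y)%E by exact: integral_ge0.
have -> : (\int[mu]_x \int[mu]_y esum [set: int] (fun k => F k x y) =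
    esum [set: int] (fun k => \int[mu]_x \int[mu]_y F k x y))%E.
  rewrite -(integral_esum_int mu mIF IF0); apply: eq_integral => x _.
  exact: (integral_esum_int mu (mFx ^~ x) (fun k => F0 k x)).
have IF k : (\int[mu]_x \int[mu]_y F k x y <= besov_const%:E * \int[mu]_x gp k x)%E.
  have dk := dyad_gt0 (R := R) k.
  have Hh : (\int[mu]_x h k x = \int[mu]_x gp k x)%E.
    apply: ge0_ae_eq_integral => //; exists N; split => // x /= nx.
    by apply: contrapT => nNx; apply: nx => _; rewrite hE.
  pose f1 x y := (if (d x y < dyad k)%R then (c k)%:E * h k x else 0)%E.
  pose f2 x y := (if (d x y < dyad k)%R then (c k)%:E * h k y else 0)%E.
  have f10 x y : (0 <= f1 x y)%E by rewrite /f1; case: ifP => // _; rewrite mule_ge0// ltW.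
  have f20 x y : (0 <= f2 x y)%E by rewrite /f2; case: ifP => // _; rewrite mule_ge0// ltW.
  have mch : measurable_fun setT (fun x => (c k)%:E * h k x)%E by exact: measurable_funeM.
  have ch0 x : (0 <= (c k)%:E * h k x)%E by rewrite mule_ge0// ltW.
  have mf1 : measurable_fun setT (fun z : X * X => f1 z.1 z.2).
    apply: (measurable_if_close dm mE x0 mupos (F := fun z => ((c k)%:E * h k z.1)%E)).
    exact: (measurableT_comp mch measurable_fst).
  have mf2 : measurable_fun setT (fun z : X * X => f2 z.1 z.2).
    apply: (measurable_if_close dm mE x0 mupos (F := fun z => ((c k)%:E * h k z.2)%E)).
    exact: (measurableT_comp mch measurable_snd).
  have F12 x y : F k x y = (f1 x y + f2 x y)%E.
    by rewrite /F /f1 /f2; case: ifP => _; rewrite ?adde0// ge0_muleDr.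
  have -> : (\int[mu]_x \int[mu]_y F k x y =
      \int[mu]_x \int[mu]_y f1 x y + \int[mu]_x \int[mu]_y f2 x y)%E.
    rewrite -ge0_integralD//; first last.
    - exact: (measurable_int_r smu mf2 f20).
    - by move=> x _; exact: integral_ge0.
    - exact: (measurable_int_r smu mf1 f10).
    - by move=> x _; exact: integral_ge0.
    apply: eq_integral => x _; rewrite -ge0_integralD//.
    - by apply: eq_integral => y _; rewrite F12.
    - exact: (measurableT_comp mf1 (pair1_measurable x)).
    - exact: (measurableT_comp mf2 (pair1_measurable x)).
  have e2 : (\int[mu]_x \int[mu]_y f2 x y = \int[mu]_x \int[mu]_y f1 x y)%E.
    rewrite (tonelli smu smu mf2 f20); apply: eq_integral => y _.
    by apply: eq_integral => x _; rewrite /f1 /f2 (metric_sym dm).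
  rewrite e2.
  have le1 := integral_close_le dk mch ch0.
  apply: (le_trans (leeD le1 le1)).
  rewrite (ge0_integralZl_EFin _ measurableT (fun x _ => h0 k x) (mh k) (ltW (c0 k))) Hh.
  have ge : (0 <= (C * dyad k `^ n * c k)%:E)%E.
    by rewrite lee_fin; exact: (mulr_ge0 (mulr_ge0 (ltW C0) (powR_ge0 _ _)) (ltW (c0 k))).
  rewrite muleA -EFinM -(ge0_muleDl _ ge ge).
  by rewrite -EFinD /c besov_const_split.
apply: (@le_trans _ _ (esum [set: int] (fun k => besov_const%:E * \int[mu]_x gp k x))%E).
  by apply: le_esum => k _; exact: IF.
rewrite esum_intZl ?(ltW besov_const_gt0)//; last by move=> k; exact: integral_ge0.
by rewrite -(integral_esum_int mu mgp gp0).
Qed.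

Lemma Bnorm_le_Mnorm (u : X -> R) :
  (Bnorm d mu s p u <= (besov_const `^ p^-1)%:E * Mnorm d mu s p u)%E.
Proof.
have pV0 : 0 <= p^-1 by rewrite invr_ge0 ltW.
have b0 := besov_const_gt0; set b := besov_const `^ p^-1.
have bp : 0 < b by rewrite powR_gt0.
(* After division by b the claim is a lower bound for the infimum [Mnorm]. *)
have -> : Bnorm d mu s p u = (b%:E * (b^-1%:E * Bnorm d mu s p u))%E.
  by rewrite muleA -EFinM divff ?mul1e// gt_eqF.
apply: lee_wpmul2l; first by rewrite lee_fin ltW.
apply: le_ereal_inf_tmp => _ [g /= hg <-].
set I := (\int[mu]_x _)%E.
have I0 : (0 <= I)%E by apply: integral_ge0 => x _; apply: esum_ge0 => k _; exact: poweR_ge0.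
have J0 : (0 <= \int[mu]_x \int[mu]_y besov_integrand d mu s p u x y)%E.
  by apply: integral_ge0 => x _; apply: integral_ge0 => y _; exact: besov_integrand_ge0.
have le : (Bnorm d mu s p u <= b%:E * poweR I p^-1)%E.
  rewrite /b -poweR_EFin -poweRM//; last by rewrite lee_fin ltW.
  apply: (gt0_ler_poweR pV0); last exact: besov_integral_le.
  - by rewrite in_itv/= leey andbT.
  - by rewrite in_itv/= leey andbT mule_ge0// lee_fin ltW.
apply: le_trans (lee_wpmul2l _ le) _; first by rewrite lee_fin invr_ge0 ltW.
by rewrite muleA -EFinM mulVf ?mul1e// gt_eqF.
Qed.
End besov.

(** * Homeomorphisms of the half-line *)

Section homeo.
Import numFieldNormedType.Exports.
Context {R : realType} (eta : R -> R).
Hypothesis he : homeo_halfline eta.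

(** The even extension to the line, to which the intermediate and extreme value theorems apply. *)
Let et (t : R) := eta `|t|.

Lemma homeo_halfline_continuous : continuous et.
Proof.
move=> t; apply/cvgrPdist_lt => e e0.
have [etainv [[_ _ _ _ ce] _]] := he.
have [del del0 h] := ce _ _ (normr_ge0 t) e0.
near=> x; rewrite distrC; apply: h => //.
apply: le_lt_trans (ler_dist_dist _ _) _; rewrite distrC.
by near: x; apply/nbhs_ballP; exists del => //= y; rewrite /ball/=.
Unshelve. all: by end_near. Qed.

(** Otherwise [eta] vanishes at some t0 > 0 and is positive at 0 and at t0 + 1; a small positive
    value is then taken on both sides of t0, against injectivity. *)
Lemma homeo_halfline0 : eta 0 = 0.
Proof.
have [etainv [[e0 i0 ei ie _] _]] := he.
apply/eqP/negPn/negP => en0.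
have ep : 0 < eta 0 by rewrite lt_neqAle eq_sym en0 e0.
pose t0 := etainv 0; have t00 : 0 <= t0 by exact: i0.
have et0 : eta t0 = 0 by exact: ie.
have t1 : 0 < eta (t0 + 1).
  rewrite lt_neqAle e0 ?addr_ge0// andbT eq_sym; apply/eqP => h.
  have t10 : 0 <= t0 + 1 by rewrite addr_ge0.
  by have := ei _ t10; rewrite h -/t0 => h'; lra.
pose v := Num.min (eta 0) (eta (t0 + 1)).
have v0 : 0 < v by rewrite lt_min ep t1.
have c a b : {within `[a, b], continuous et}.
  by apply: continuous_subspaceT => x; exact: homeo_halfline_continuous.
have [c1 c1i c1v] : exists2 c, c \in `[0, t0] & et c = v.
  apply: (IVT t00 (c 0 t0)); rewrite /et normr0 (ger0_norm t00) et0.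
  by rewrite min_r ?max_l ?(ltW ep)// (ltW v0) ge_min lexx.
have t01 : t0 <= t0 + 1 by lra.
have [c2 c2i c2v] : exists2 c, c \in `[t0, t0 + 1] & et c = v.
  apply: (IVT t01 (c t0 (t0 + 1))); rewrite /et (ger0_norm t00) (@ger0_norm _ (t0 + 1)); last lra.
  by rewrite et0 min_l ?max_r ?(ltW t1)// (ltW v0) ge_min lexx orbT.
move: c1i c2i; rewrite !in_itv/= => /andP[c10 c1t] /andP[c2t _].
have c20 : 0 <= c2 by lra.
move: c1v c2v; rewrite /et !ger0_norm// => c1v c2v.
have c12 : c1 = c2 by rewrite -(ei _ c10) -(ei _ c20) c1v c2v.
have ct : c1 = t0 by lra.
by move: v0; rewrite -c1v ct et0 ltxx.
Qed.

Lemma homeo_halfline_bounded (T : R) : exists2 H, 1 <= H & forall t, 0 <= t <= T -> eta t <= H.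
Proof.
have [T0|T0] := leP 0 T; last by exists 1 => // t; lra.
have c : {within `[0, T], continuous et}.
  by apply: continuous_subspaceT => x; exact: homeo_halfline_continuous.
have [c1 _ hc] := EVT_max T0 c.
exists (Num.max 1 (et c1)); first by rewrite le_max lexx.
move=> t tT; rewrite le_max; apply/orP; right.
have := hc t; rewrite in_itv/= => /(_ tT); rewrite {1}/et ger0_norm//.
by case/andP: tT.
Qed.

Lemma homeo_halfline_small (e : R) : 0 < e -> exists2 del, 0 < del &
  forall t, 0 <= t < del -> eta t < e.
Proof.
move=> e0; have [etainv [[p0 _ _ _ ce] _]] := he.
have [del del0 h] := ce 0 e (lexx 0) e0; exists del => // t /andP[t0 td].
have := h t t0; rewrite subr0 (ger0_norm t0) homeo_halfline0 subr0 => /(_ td).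
by rewrite ger0_norm// p0.
Qed.
End homeo.

(** * Comparison of distances under [f] and under its inverse *)

Section qs_controls.
Context {R : realType} {X Y : Type} (dX : X -> X -> R) (dY : Y -> Y -> R).
Variables (f : X -> Y) (finv : Y -> X).
Hypotheses (mX : is_metric dX) (mY : is_metric dY).
Hypothesis qs : quasisymmetric dX dY f finv.

(** [H] bounds [eta] on [0, T]; for x = b, where the ratio inequality is silent, the hypothesis
    forces a = x. *)
Lemma quasisymmetric_control : qs_control dX (fun a b => dY (f a) (f b)).
Proof.
move: qs => [fK fK' _ _ [eta [he hq]]] T.
have [H H1 hH] := homeo_halfline_bounded he T.
exists H => // x a b h.
have [xb|xb] := pselect (x = b).
  have -> : a = x.
    have [//|xa] := pselect (a = x).
    have xa0 := metric_gt0 mX (fun e : x = a => xa (esym e)).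
    have := metric_xx mX b; rewrite -xb => xx.
    by move: h; rewrite -xb xx mulr0 leNgt xa0.
  by rewrite (metric_xx mY) mulr_ge0 ?(metric_ge0 mY)// (le_trans ler01 H1).
have xb0 := metric_gt0 mX xb.
have fxb : 0 < dY (f x) (f b) by apply: (metric_gt0 mY) => /(can_inj fK).
rewrite -ler_pdivrMr//; apply: le_trans (hq a b x xb) _; apply: hH.
by rewrite divr_ge0 ?(metric_ge0 mX)//= ler_pdivrMr.
Qed.

(** If the claim failed, d(x', b') / d(x', a') would be so small that [eta] of it is below 1 / T';
    applying [f] then gives T' d(x, b) < d(x, a), against the hypothesis as T <= T'. *)
Lemma quasisymmetric_control_inv : qs_control dY (fun a b => dX (finv a) (finv b)).
Proof.
move: qs => [fK fK' _ _ [eta [he hq]]] T.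
pose T' := Num.max 1 T; have T'1 : 1 <= T' by rewrite le_max lexx.
have TT' : T <= T' by rewrite le_max lexx orbT.
have T'0 : 0 < T'^-1 by rewrite invr_gt0; lra.
have [del del0 hdel] := homeo_halfline_small he T'0.
have del2 : 0 < 2 / del by rewrite divr_gt0.
exists (Num.max 1 (2 / del)); first by rewrite le_max lexx.
set H := Num.max _ _; have H1 : 1 <= H by rewrite le_max lexx.
have Hd : 2 / del <= H by rewrite le_max lexx orbT.
move=> x a b h; rewrite leNgt; apply/negP => h'.
set x' := finv x in h' *; set a' := finv a in h'; set b' := finv b in h'.
have b0 : 0 <= dX x' b' by exact: (metric_ge0 mX).
have a0 : 0 < dX x' a' by apply: le_lt_trans h'; rewrite mulr_ge0//; lra.
have xa : x' <> a' by move=> xa; move: a0; rewrite xa (metric_xx mX) ltxx.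
have fxa : 0 < dY (f x') (f a') by apply: (metric_gt0 mY) => /(can_inj fK).
have small : eta (dX x' b' / dX x' a') < T'^-1.
  apply: hdel; rewrite divr_ge0 ?(metric_ge0 mX)//= ltr_pdivrMr//.
  have : 2 * dX x' b' <= del * (H * dX x' b').
    rewrite mulrA ler_wpM2r//; by move: Hd; rewrite ler_pdivrMr// mulrC.
  have : del * (H * dX x' b') < del * dX x' a' by rewrite ltr_pM2l.
  by clear xa; lra.
have := le_lt_trans (hq b' a' x' xa) small; clear xa.
rewrite ltr_pdivrMr// mulrC ltr_pdivlMr; last lra.
rewrite /x' /a' /b' !fK' => h2.
have : T * dY x b <= T' * dY x b by rewrite ler_wpM2r// (metric_ge0 mY).
by lra.
Qed.
End qs_controls.

Definition pushforward_measure {R : realType} {d1 d2} {T1 : measurableType d1}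
  {T2 : measurableType d2} (m : {measure set T1 -> \bar R}) (f : T1 -> T2)
  (mf : measurable_fun setT f) : {measure set T2 -> \bar R} :=
  measure_function_pushforward__canonical__measure_function_Measure m mf.

Lemma ge0_integral_pushforwardT {R : realType} {d1 d2} {T1 : measurableType d1}
  {T2 : measurableType d2} (m : {measure set T1 -> \bar R}) (f : T1 -> T2)
  (mf : measurable_fun setT f) (g : T2 -> \bar R) :
  measurable_fun setT g -> (forall y, 0 <= g y)%E ->
  (\int[pushforward_measure m mf]_y g y = \int[m]_x g (f x))%E.
Proof.
move=> mg g0; have := ge0_integral_pushforward mf m measurableT mg (fun y _ => g0 y).
by rewrite preimage_setT.
Qed.

(** * Transport of the energy by the map *)

Section transport.
Context {R : realType} {d1 d2 : measure_display} {X : measurableType d1} {Y : measurableType d2}.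
Variables (dX : X -> X -> R) (muX : {measure set X -> \bar R}).
Variables (dY : Y -> Y -> R) (muY : {measure set Y -> \bar R}).
Variables (n1 n2 s1 s2 p : R) (f : X -> Y) (finv : Y -> X).
Hypotheses (hX : metric_measure_space dX muX) (hY : metric_measure_space dY muY).
Hypotheses (n10 : 0 < n1) (n20 : 0 < n2).
Hypotheses (aX : ahlfors_regular dX muX n1) (aY : ahlfors_regular dY muY n2).
Hypotheses (fK : cancel f finv) (finvK : cancel finv f).
Hypotheses (mf : measurable_fun setT f) (mfinv : measurable_fun setT finv).
Hypothesis qs : qs_control dX (fun a b => dY (f a) (f b)).
Hypotheses (s10 : 0 < s1) (s20 : 0 < s2) (p1 : 1 < p).
Hypotheses (sp1 : s1 * p = n1) (sp2 : s2 * p = n2).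

Lemma besov_to_hajlasz (x0 y0 : X) : x0 <> y0 -> exists2 K : R, 0 < K &
  forall u : Y -> R, measurable_fun setT u -> (Bnorm dY muY s2 p u < +oo)%E ->
  exists ut : Y -> R, [/\ {ae muY, forall y, ut y = u y},
    measurable_fun setT (ut \o f) &
    (Mnorm dX muX s1 p (ut \o f) <= K%:E * Bnorm dY muY s2 p u)%E].
Proof.
move=> xy0; have fxy0 : f x0 <> f y0 by move/(can_inj fK).
have p0 : 0 < p by exact: lt_trans p1.
case: hX => dmX mEX _ posX; case: hY => dmY mEY _ posY.
case: aX => C1 C11 hA1; case: aY => C2 C21 hA2.
pose rho a b := dY (f a) (f b).
have rm : is_metric rho.
  case: dmY => h1 h2 h3 h4; split; rewrite /rho => //.
  by move=> x y; split => [/h2/(can_inj fK)//|->]; apply/h2.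
pose nu := pushforward_measure muY mfinv.
have nuB x r : nu (mball rho x r) = muY (mball dY (f x) r).
  rewrite /nu/= /pushforward; congr (muY _); apply/seteqP.
  by split => y; rewrite /mball/= /rho finvK.
have mBr x r : measurable (mball rho x r).
  by have := mf measurableT (measurable_mball dmY mEY (f x) r); rewrite setTI.
have mBd := measurable_mball dmX mEX.
have hAr : ahlfors_with rho nu n2 C2.
  move=> x r r0 [a [b h]]; rewrite nuB; apply: hA2 => //.
  by exists (f a), (f b).
have posr x r : 0 < r -> (0 < nu (mball rho x r) < +oo)%E by rewrite nuB; exact: posY.
have nupos x r : 0 < r -> (0 < nu (mball dX x r) < +oo)%E.
  exact: (qs_mball_finite dmX rm mBd mBr posr qs x xy0).
have [D D2 hD] := qs_doubling dmX rm mBd mBr n20 C21 hAr qs.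
have [A A1 hA] := qs_dist_le_mball rm mBd mBr n20 C21 hAr qs.
have [S S0 hS] := sum_inv_vol2_le dmX mEX nupos D2 hD n10 C11 hA1 xy0.
pose e2 : R := - (n2 + n2).
(* The square of [qs_dist_le_mball]. As s2 p = n2, the power rho^(-2 n2) is also the Besov kernel of
   Y up to constants. *)
pose kap z w := A ^+ 2 * rho z w `^ e2.
have mdY := measurable_distance dmY mEY (f x0) posY.
have mrho : measurable_fun setT (fun z : X * X => rho z.1 z.2).
  apply: (measurableT_comp mdY (g := fun z : X * X => (f z.1, f z.2))).
  apply: measurable_fun_pair; exact: measurableT_comp.
have mkap : measurable_fun setT (fun z : X * X => kap z.1 z.2).
  apply: measurable_funM => //; exact: (measurableT_comp (measurable_powR e2) mrho).
have kap0 z w : 0 <= kap z w by rewrite mulr_ge0 ?powR_ge0// exprn_ge0// (le_trans ler01 A1).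
have A0 : 0 < A by exact: lt_le_trans A1.
have hkap z w : z <> w -> (bvol dX nu z (dX z w) ^+ 2)^-1 <= kap z w.
  move=> zw; have zw0 := metric_gt0 dmX zw; have rzw := metric_gt0 rm zw.
  have V0 := bvol_gt0 nupos z zw0.
  have := hA _ _ zw; rewrite (bvolE nupos)// -EFinM lee_fin => h.
  have rn : 0 < rho z w `^ n2 by rewrite powR_gt0.
  rewrite /kap /e2 powRN powRD; last by apply/implyP => _; rewrite gt_eqF.
  rewrite ler_pdivlMr ?mulr_gt0// mulrC ler_pdivrMr ?exprn_gt0// -exprMn -expr2.
  by rewrite ler_sqr ?nnegrE ?powR_ge0 ?mulr_ge0 ?(ltW A0) ?(ltW V0).
pose N := norm_const n1 C1 D S p s1.
have N0 : 0 < N by exact: norm_const_gt0.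
have C20 : 0 < C2 by exact: lt_le_trans C21.
(* N for the gradient, A^2 from [kap], C2 from [besov_integrand_lower]. *)
pose K := N * (A ^+ 2 * C2); have K0 : 0 < K by exact: (mulr_gt0 N0 (mulr_gt0 (exprn_gt0 2 A0) C20)).
exists (K `^ p^-1); first exact: powR_gt0.
move=> u mu Boo; pose U := u \o f.
have mU : measurable_fun setT U by exact: measurableT_comp.
have sY : sigma_finite setT muY := besov_sigma_finite dmY mEY posY (f x0).
pose e y y' := (`|u y - u y'| `^ p * (C2^-1 * dY y y' `^ e2))%:E.
have e0 y y' : (0 <= e y y')%E.
  by rewrite lee_fin mulr_ge0 ?powR_ge0// mulr_ge0 ?powR_ge0// invr_ge0 ltW.
have me : measurable_fun setT (fun z : Y * Y => e z.1 z.2).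
  rewrite /e; under eq_fun do rewrite EFinM.
  apply: emeasurable_funM; first exact: measurable_pow_dist2.
  apply/measurable_EFinP; apply: measurable_funM => //.
  exact: (measurableT_comp (measurable_powR e2) mdY).
pose J := (\int[muY]_y \int[muY]_y' besov_integrand dY muY s2 p u y y')%E.
have J0 : (0 <= J)%E.
  by apply: integral_ge0 => y _; apply: integral_ge0 => y' _; exact: besov_integrand_ge0.
have Jfin : (J < +oo)%E by exact: (Bnorm_pinfty p0).
have eJ : (\int[muY]_y \int[muY]_y' e y y' <= J)%E.
  apply: ge0_le_integral_any => y; first exact: integral_ge0.
  apply: ge0_le_integral_any => y' //.
  exact: (besov_integrand_lower dmY mEY posY p0 n20 C21 hA2 fxy0 sp2).
have c0 : 0 < A ^+ 2 * C2 by rewrite mulr_gt0// exprn_gt0.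
have kE z w : (`|U z - U w| `^ p * kap z w)%:E = ((A ^+ 2 * C2)%:E * e (f z) (f w))%E.
  rewrite -EFinM; congr (_%:E); rewrite /kap /U /rho /=.
  have : C2 != 0 by rewrite gt_eqF.
  by move: (_ `^ e2) (_ `^ p) (A ^+ 2) => a b c C20'; field.
have mef z : measurable_fun setT (fun w => e (f z) (f w)).
  exact: (measurableT_comp (measurableT_comp me (pair1_measurable (f z))) mf).
have mIe : measurable_fun setT (fun y => \int[muY]_y' e y y')%E.
  exact: (measurable_int_r sY me e0).
have IE : energy nu p U kap = ((A ^+ 2 * C2)%:E * \int[muY]_y \int[muY]_y' e y y')%E.
  have inner z : (\int[nu]_w (`|U z - U w| `^ p * kap z w)%:E =
      (A ^+ 2 * C2)%:E * \int[muY]_y' e (f z) y')%E.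
    under eq_integral do rewrite kE.
    rewrite (ge0_integralZl_EFin _ measurableT (fun w _ => e0 (f z) (f w)) (mef z) (ltW c0)).
    rewrite (ge0_integral_pushforwardT muY mfinv (mef z) (fun w => e0 _ _)).
    by congr (_ * _)%E; apply: eq_integral => y' _; rewrite finvK.
  rewrite /energy; under eq_integral do rewrite inner.
  have mI : measurable_fun setT (fun z => \int[muY]_y' e (f z) y')%E.
    exact: (measurableT_comp mIe mf).
  have I0 z : (0 <= \int[muY]_y' e (f z) y')%E by exact: integral_ge0.
  rewrite (ge0_integralZl_EFin _ measurableT (fun z _ => I0 z) mI (ltW c0)).
  rewrite (ge0_integral_pushforwardT muY mfinv mI I0).
  apply: congr1.
  apply: eq_integral => y _.
  by rewrite finvK.
have Eoo : (energy nu p U kap < +oo)%E.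
  rewrite IE lte_mul_pinfty ?lee_fin ?(ltW c0)//; exact: le_lt_trans Jfin.
pose v := representative dX nu U.
have vf : (v \o finv) \o f = v by apply/funext => x /=; rewrite fK.
exists (v \o finv); rewrite vf; split.
(* The [nu]-mass of a set is by definition the [muY]-mass of its preimage under [finv], so null sets
   go over. *)
- have [B [mB nB sub]] := representative_ae dmX mEX posX nupos xy0 p1 S0 hS mU mkap kap0 hkap Eoo.
  exists (finv @^-1` B); split => //.
    by have := mfinv measurableT mB; rewrite setTI.
  move=> y /= hy; apply: sub => /= vU; apply: hy.
  by rewrite /v vU /U /= finvK.
- by refine (measurable_representative dmX mEX x0 posX nupos mU).
- have pV0 : 0 <= p^-1 by rewrite invr_ge0 ltW.
  apply: le_trans (Mnorm_representative_le dmX mEX posX nupos D2 hD n10 C11 hA1 xy0 p1 S0 hS mU mkap kap0 hkap Eoo s10 sp1) _.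
  rewrite /Bnorm -/J -poweR_EFin -poweRM ?lee_fin ?(ltW K0)//.
  have NE0 : (0 <= N%:E * energy nu p U kap)%E.
    by rewrite mule_ge0 ?lee_fin ?(ltW N0)// IE mule_ge0 ?lee_fin ?(ltW c0)// integral_ge0// => y _; exact: integral_ge0.
  apply: (gt0_ler_poweR pV0).
  + by rewrite in_itv/= leey andbT.
  + by rewrite in_itv/= leey andbT mule_ge0// lee_fin ltW.
  + by rewrite IE muleA -EFinM lee_wpmul2l// lee_fin ltW.
Qed.
End transport.

(** * One-point spaces, where both norms vanish *)

Section one_point.
Context {R : realType} {dsp : measure_display} {X : measurableType dsp}.
Variables (d : X -> X -> R) (mu : {measure set X -> \bar R}) (s p : R).
Hypotheses (hX : metric_measure_space d mu) (one : forall x y : X, x = y) (p0 : 0 < p).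

Lemma Mnorm_ge0 (u : X -> R) : (0 <= Mnorm d mu s p u)%E.
Proof. by apply: le_ereal_inf_tmp => _ [g _ <-]; exact: poweR_ge0. Qed.

(** No pair of points lies in a dyadic shell, so the zero sequence is a Hajlasz gradient. *)
Lemma one_point_Mnorm (u : X -> R) : Mnorm d mu s p u = 0%E.
Proof.
have pN : p != 0 by rewrite gt_eqF.
have pV : p^-1 != 0 by rewrite invr_neq0.
apply/eqP; rewrite eq_le Mnorm_ge0 andbT; apply: ereal_inf_lbound.
exists (fun _ _ => 0%E); last first.
  rewrite (_ : integral _ _ _ = 0%E) ?poweR0r//; apply: integral0_eq => x _.
  by apply: esum1 => k _ /=.
split => //; split => //; exists set0; split; first exact: negligible_set0.
move=> k x y _ _ /andP[h _]; case: hX => dm _ _ _.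
by move: h; rewrite (one x y) metric_xx// leNgt powR_gt0.
Qed.

Lemma one_point_Bnorm (u : X -> R) : Bnorm d mu s p u = 0%E.
Proof.
have pV : p^-1 != 0 by rewrite invr_neq0// gt_eqF.
rewrite /Bnorm (_ : integral _ _ _ = 0%E) ?poweR0r//; apply: integral0_eq => x _.
by apply: integral0_eq => y _; rewrite (one y x) besov_integrandxx.
Qed.

Lemma one_point_in_Mdot (u : X -> R) : measurable_fun setT u -> in_Mdot d mu s p u.
Proof. by split => //; rewrite one_point_Mnorm. Qed.

Lemma one_point_in_Bdot (u : X -> R) : measurable_fun setT u -> in_Bdot d mu s p u.
Proof.
move=> mU; split; last by rewrite one_point_Bnorm.
case: hX => dm mE _ pos; split => // x r r0.
rewrite (_ : integral _ _ _ = \int[mu]_(y in mball d x r) cst (`|u x| `^ p)%:E y)%E; last first.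
  by apply: eq_integral => y _; rewrite (one y x).
rewrite integral_cst; last exact: (measurable_mball dm mE).
by rewrite lte_mul_pinfty// ?lee_fin ?powR_ge0//; have /andP[] := pos x r r0.
Qed.
End one_point.

(** * Both norm bounds for a map in one direction *)

Section one_direction.
Context {R : realType} {d1 d2 : measure_display} {X : measurableType d1} {Y : measurableType d2}.
Variables (dX : X -> X -> R) (muX : {measure set X -> \bar R}).
Variables (dY : Y -> Y -> R) (muY : {measure set Y -> \bar R}).
Variables (n1 n2 s1 s2 p : R) (f : X -> Y) (finv : Y -> X).

(** Stated with [qs_control] so that it serves [f] and its inverse alike. Hajlasz on X is bounded by
    Besov on Y, then by Hajlasz on Y; Besov on X by Hajlasz on X, then by Besov on Y. *)
Lemma qs_control_composition :
  metric_measure_space dX muX -> metric_measure_space dY muY ->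
  0 < n1 -> 0 < n2 ->
  ahlfors_regular dX muX n1 -> ahlfors_regular dY muY n2 ->
  cancel f finv -> cancel finv f ->
  measurable_fun setT f -> measurable_fun setT finv ->
  qs_control dX (fun a b => dY (f a) (f b)) ->
  0 < s1 -> 0 < s2 -> 1 < p -> s1 * p = n1 -> s2 * p = n2 ->
  exists2 K : R, 0 < K &
  (forall u : Y -> R, in_Mdot dY muY s2 p u ->
     exists ut : Y -> R, {ae muY, forall y, ut y = u y} /\
       in_Mdot dX muX s1 p (ut \o f) /\
       (Mnorm dX muX s1 p (ut \o f) <= K%:E * Mnorm dY muY s2 p u)%E) /\
  (forall u : Y -> R, in_Bdot dY muY s2 p u ->
     exists ut : Y -> R, {ae muY, forall y, ut y = u y} /\
       in_Bdot dX muX s1 p (ut \o f) /\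
       (Bnorm dX muX s1 p (ut \o f) <= K%:E * Bnorm dY muY s2 p u)%E).
Proof.
move=> hX hY n10 n20 aX aY fK finvK mf mfinv qs s10 s20 p1 sp1 sp2.
have p0 : 0 < p by exact: lt_trans p1.
have [[x0 [y0 xy0]]|one] := pselect (exists x y : X, x <> y); last first.
  have oneX (x y : X) : x = y by apply: contrapT => xy; apply: one; exists x, y.
  have oneY (x y : Y) : x = y by rewrite -(finvK x) -(finvK y) (oneX (finv x) (finv y)).
  exists 1 => //; split => u [hu _]; exists u; (split; first exact: aeW).
    have muf : measurable_fun setT (u \o f) by exact: measurableT_comp.
    split; first exact: (one_point_in_Mdot s1 hX oneX p0 muf).
    by rewrite (one_point_Mnorm s1 hX oneX p0) (one_point_Mnorm s2 hY oneY p0) mule0.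
  have muf : measurable_fun setT (u \o f) by apply: measurableT_comp => //; case: hu.
  split; first exact: (one_point_in_Bdot s1 hX oneX p0 muf).
  by rewrite (one_point_Bnorm dX muX s1 oneX p0) (one_point_Bnorm dY muY s2 oneY p0) mule0.
have fxy0 : f x0 <> f y0 by move/(can_inj fK).
have [K K0 hK] := besov_to_hajlasz hX hY n10 n20 aX aY fK finvK mf mfinv qs s10 p1 sp1 sp2 xy0.
case: (hX) => dmX mEX _ posX; case: (hY) => dmY mEY _ posY.
case: (aX) => C1 C11 hA1; case: (aY) => C2 C21 hA2.
have Bfin (u : X -> R) := Bnorm_le_Mnorm dmX mEX posX p0 n10 C11 hA1 xy0 sp1 u.
have BY (u : Y -> R) := Bnorm_le_Mnorm dmY mEY posY p0 n20 C21 hA2 fxy0 sp2 u.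
set bX := besov_const _ _ _ `^ _ in Bfin; set bY := besov_const _ _ _ `^ _ in BY.
have bX0 : 0 < bX by rewrite powR_gt0// besov_const_gt0.
have bY0 : 0 < bY by rewrite powR_gt0// besov_const_gt0.
(* The sum of the constants of the two chains. *)
exists (K * bY + bX * K); first by rewrite addr_gt0// mulr_gt0.
have Mle c (t : \bar R) : (0 <= t)%E -> c <= K * bY + bX * K ->
    (c%:E * t <= (K * bY + bX * K)%:E * t)%E.
  by move=> t0 hc; rewrite lee_wpmul2r// lee_fin.
split => u [hu unorm].
  have Boo : (Bnorm dY muY s2 p u < +oo)%E.
    by apply: le_lt_trans (BY u) _; rewrite lte_mul_pinfty// lee_fin ltW.
  have [ut [ae mut le]] := hK u hu Boo.
  have le' : (Mnorm dX muX s1 p (ut \o f) <= (K * bY)%:E * Mnorm dY muY s2 p u)%E.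
    by apply: (le_trans le); rewrite EFinM -muleA lee_wpmul2l// lee_fin ltW.
  exists ut; split => //; split.
    by split => //; apply: le_lt_trans le' _; rewrite lte_mul_pinfty// lee_fin ltW// mulr_gt0.
  apply: (le_trans le'); apply: Mle; first exact: Mnorm_ge0.
  by rewrite lerDl mulr_ge0// ltW.
have [ut [ae mut le]] := hK u hu.1 unorm.
have le' : (Bnorm dX muX s1 p (ut \o f) <= (bX * K)%:E * Bnorm dY muY s2 p u)%E.
  by apply: (le_trans (Bfin _)); rewrite EFinM -muleA lee_wpmul2l// lee_fin ltW.
have Boo : (Bnorm dX muX s1 p (ut \o f) < +oo)%E.
  by apply: le_lt_trans le' _; rewrite lte_mul_pinfty// lee_fin ltW// mulr_gt0.
exists ut; split => //; split.
  by split => //; exact: (Lp_loc_of_Bnorm dmX mEX posX p0 s10 mut Boo).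
apply: (le_trans le'); apply: Mle; first exact: poweR_ge0.
by rewrite lerDr mulr_ge0// ltW.
Qed.
End one_direction.

Theorem theorem5p1 (R : realType)
  (dspX : measure_display) (X : measurableType dspX)
  (dX : X -> X -> R) (muX : {measure set X -> \bar R})
  (dspY : measure_display) (Y : measurableType dspY)
  (dY : Y -> Y -> R) (muY : {measure set Y -> \bar R})
  (n1 n2 s1 s2 : R) (f : X -> Y) (finv : Y -> X) :
  metric_measure_space dX muX -> metric_measure_space dY muY ->
  0 < n1 -> 0 < n2 ->
  ahlfors_regular dX muX n1 -> ahlfors_regular dY muY n2 ->
  quasisymmetric dX dY f finv ->
  0 < s1 < n1 -> 0 < s2 < n2 -> n1 / s1 = n2 / s2 ->
  exists2 C : R, 0 < C &
  [/\ forall u : Y -> R, in_Mdot dY muY s2 (n2 / s2) u ->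
        exists ut : Y -> R, {ae muY, forall y, ut y = u y} /\
          in_Mdot dX muX s1 (n1 / s1) (ut \o f) /\
          (Mnorm dX muX s1 (n1 / s1) (ut \o f)
             <= C%:E * Mnorm dY muY s2 (n2 / s2) u)%E,
      forall v : X -> R, in_Mdot dX muX s1 (n1 / s1) v ->
        exists vt : X -> R, {ae muX, forall x, vt x = v x} /\
          in_Mdot dY muY s2 (n2 / s2) (vt \o finv) /\
          (Mnorm dY muY s2 (n2 / s2) (vt \o finv)
             <= C%:E * Mnorm dX muX s1 (n1 / s1) v)%E,
      forall u : Y -> R, in_Bdot dY muY s2 (n2 / s2) u ->
        exists ut : Y -> R, {ae muY, forall y, ut y = u y} /\
          in_Bdot dX muX s1 (n1 / s1) (ut \o f) /\
          (Bnorm dX muX s1 (n1 / s1) (ut \o f)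
             <= C%:E * Bnorm dY muY s2 (n2 / s2) u)%E &
      forall v : X -> R, in_Bdot dX muX s1 (n1 / s1) v ->
        exists vt : X -> R, {ae muX, forall x, vt x = v x} /\
          in_Bdot dY muY s2 (n2 / s2) (vt \o finv) /\
          (Bnorm dY muY s2 (n2 / s2) (vt \o finv)
             <= C%:E * Bnorm dX muX s1 (n1 / s1) v)%E].
Proof.
move=> hX hY n10 n20 aX aY qs /andP[s10 s1n] /andP[s20 s2n] nn.
case: (hX) => mX mEX _ _; case: (hY) => mY mEY _ _; case: (qs) => fK finvK cf cfinv _.
have mf := metric_continuous_measurable mEX mEY cf.
have mfinv := metric_continuous_measurable mEY mEX cfinv.
(* s1 < n1 enters as p > 1, which lies behind Jensen for averages and integrability on balls. *)
have p1 : 1 < n1 / s1 by rewrite ltr_pdivlMr// mul1r.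
have sp1 : s1 * (n1 / s1) = n1 by rewrite mulrC divfK// gt_eqF.
have sp2 : s2 * (n1 / s1) = n2 by rewrite nn mulrC divfK// gt_eqF.
have [K K0 [KM KB]] := qs_control_composition hX hY n10 n20 aX aY fK finvK mf mfinv
  (quasisymmetric_control mX mY qs) s10 s20 p1 sp1 sp2.
have [L L0 [LM LB]] := qs_control_composition hY hX n20 n10 aY aX finvK fK mfinv mf
  (quasisymmetric_control_inv mX mY qs) s20 s10 p1 sp2 sp1.
rewrite -nn; exists (K + L); first exact: addr_gt0.
have up c (t : \bar R) : (0 <= t)%E -> c <= K + L -> (c%:E * t <= (K + L)%:E * t)%E.
  by move=> t0 h; rewrite lee_wpmul2r// lee_fin.
have KL : K <= K + L by rewrite lerDl ltW.
have LK : L <= K + L by rewrite lerDr ltW.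
split=> [u /KM|v /LM|u /KB|v /LB] [ut [ae [ut_in le]]]; exists ut; split => //; split => //;
  apply: le_trans le (up _ _ _ _) => //; try exact: Mnorm_ge0; exact: poweR_ge0.
Qed.
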